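(* Let $q$ be a prime power, $n$ a positive integer, $0<t\le n$ an integer and $b=1+q^t$. Assume $(q,n,b)\neq(2,2,3)$ and that the polynomial $\mathrm{Tr}(X)=\mathrm{Tr}_b(X)$ has $m=q^{2n-1-t}+q^{2n-1}$ different roots $\beta_1,\dots,\beta_m$ in $\mathbb{F}_{q^{2n}}$. Fix a positive integer $n'<n$ such that $n'$ divides $n$. Let $\mathfrak{S}=\{g_0<g_1<\cdots<g_\omega\}\subset\mathfrak{G}=\{0,1,\dots,q^{2n}-2\}$ be the ordered set of minimal representatives of the cyclotomic cosets of $\mathbb{Z}_{q^{2n}-1}$ with respect to $q^{2n'}$. Let $A(q,t)$ be as in the context and set $$B(q,t):=q^n-(q-1)q^{n-t}-q,\quad B^1(q,t):=q^n-(q-1)q^{n-t}-2,\quad C(q,t):=\frac{q^{2n-2}-1}{q^{n-2}+1}.$$ Define $D(q,t)$ as follows. - If $t>1$: $D(q,t):=A(q,t)$ when $n'\neq1$; and, when $n'=1$, $D(q,t):=B(q,t)$ if $n$ is even and $D(q,t):=\min\{A(q,t),B(q,t)\}$ otherwise. - If $t=1$ and $n\ne2$: $D(q,t):=A(q,t)$ when $n'>2$; $D(q,t):=C(q,t)$ when $n'=2$; $D(q,t):=B^1(q,t)$ when $n'=1$. - If $t=1$ and $n=2$: $D(q,t):=q-2$. Then, for each element $g_\tau\in\mathfrak{S}$ (with $\tau<\omega$) such that $g_\tau\le D(q,t)$, the subfield-subcode $E_{\Gamma(\tau)^{\mathcal{H}},\mathrm{Tr}}|_{\mathbb{F}_{q^{2n'}}}$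 is Hermitian self-orthogonal and, as a consequence, there exists a stabilizer quantum code with parameters $$\left[\left[q^{2n-1-t}+q^{2n-1},\ \ge q^{2n-1-t}+q^{2n-1}-2\sum_{\ell=0}^{\tau}\#\mathfrak{C}_{g_\ell},\ \ge g_{\tau+1}+1\right]\right]_{q^{n'}}.$$
   Context: For a positive integer $j$ put $\mathrm{tr}_j(X)=X+X^q+\cdots+X^{q^{j-1}}$. For $b=1+q^t$ with $0<t\le n$, let $P_b(X)=1+\mathrm{tr}_{2n}(X^b)$ if $0<t<n$, and $P_b(X)=1+\mathrm{tr}_n(X^b)$ if $t=n$. The $b$th trace-depending polynomial $\mathrm{Tr}_b(X)\in\mathbb{F}_{q^{2n}}[X]$ is the representative of minimum degree of the class of $P_b(X)$ in $\mathbb{F}_{q^{2n}}[X]/\langle X^{q^{2n}-1}-1\rangle$. The evaluation map $\mathrm{ev}_{\mathrm{Tr}}:\mathbb{F}_{q^{2n}}[X]/\langle\mathrm{Tr}(X)\rangle\to\mathbb{F}_{q^{2n}}^m$ is $h\mapsto(h(\beta_1),\dots,h(\beta_m))$. Definition of $A(q,t)$: for $q\ne2$, $A(q,t)=q^n-\lceil\frac{q-1}{2}\rceil q^{n-1}-\lceil\frac{q-1}{2}\rceil q^{n-t-1}-2$ if $0<t\le\frac n2$; $A(q,t)=q^n-\lceil\frac{q-1}{2}\rceil q^{n-1}-\lceil\frac{q-1}{2}\rceil q^{t-1}-2$ if $\frac n2<t<n$; $A(q,t)=q^{n-1}-2$ if $t=n$. For $q=2$, $A(q,t)=2^n-2^{t-1}-2$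 if $t<n$ and $A(q,t)=2^{n-1}-2$ if $t=n$. Cyclotomic cosets: identify $\mathfrak{G}=\{0,1,\dots,q^{2n}-2\}$ with $\mathbb{Z}_{q^{2n}-1}$. The cyclotomic coset of $g$ with respect to $q^{2n'}$ is $\mathfrak{C}_g=\{q^{2n'i}g \bmod (q^{2n}-1)\mid i\ge0\}\subset\mathfrak{G}$; $g$ is its minimal representative if $g=\min\mathfrak{C}_g$; $\#$ denotes cardinality. Put $\Gamma(\tau)=\mathfrak{C}_{g_0}\cup\mathfrak{C}_{g_1}\cup\cdots\cup\mathfrak{C}_{g_\tau}$. The code $E_{\Gamma(\tau)^{\mathcal{H}},\mathrm{Tr}}\subseteq\mathbb{F}_{q^{2n}}^m$ is the $\mathbb{F}_{q^{2n}}$-linear code generated by the images under $\mathrm{ev}_{\mathrm{Tr}}$ of the classes modulo $\langle\mathrm{Tr}(X)\rangle$ of the monomials $X^i$, $i\in\Gamma(\tau)$; that is, it is spanned by the vectors $(\beta_1^i,\dots,\beta_m^i)$, $i\in\Gamma(\tau)$. Its subfield-subcode over $\mathbb{F}_{q^{2n'}}$ is $E_{\Gamma(\tau)^{\mathcal{H}},\mathrm{Tr}}|_{\mathbb{F}_{q^{2n'}}}=E_{\Gamma(\tau)^{\mathcal{H}},\mathrm{Tr}}\cap\mathbb{F}_{q^{2n'}}^m$. Hermitian self-orthogonality of a linear code over $\mathbb{F}_{q^{2n'}}$ is with respect to $x\cdot_h y=\sum_j x_jy_j^{q^{n'}}$, i.e. $C\subseteq C^{\perp_h}$. For a prime power $Q$,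 a stabilizer quantum code is a nonzero subspace of $\mathbb{C}^{Q^N}$ which is the intersection of the eigenspaces with eigenvalue $1$ of the elements of an abelian subgroup of the error group generated by a suitable (standard) error basis on $\mathbb{C}^{Q^N}$; it has parameters $[[N,K,d]]_Q$ if it has dimension $Q^K$ and minimum distance $d$. A symbol ''$\ge x$'' in a parameter position means that the parameter is at least $x$. *)

(* Defs.v *)
From HB Require Import structures.
From mathcomp Require Import all_boot all_order all_algebra.
From mathcomp Require Import reals complex.

Set Implicit Arguments.
Unset Strict Implicit.
Unset Printing Implicit Defensive.

Import Order.TTheory GRing.Theory Num.Theory.

Local Open Scope ring_scope.

Section TraceDependingPolynomial.
Variable F : finFieldType.
Implicit Types f g : {poly F}.

(* tr_j evaluated at the polynomial f. *)
Definition tr_poly (q j : nat) f : {poly F} := \sum_(i < j) f ^+ (q ^ i).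

Definition P_poly (q n t : nat) : {poly F} :=
  1 + tr_poly q (if t == n then n else 2 * n)%N 'X^(1 + q ^ t).

(* The representative of minimum degree of a class is the remainder: see
   Tr_poly_class and Tr_poly_min. *)
Definition Tr_poly (q n t : nat) : {poly F} :=
  P_poly q n t %% ('X^(q ^ (2 * n) - 1) - 1).

Lemma Tr_poly_class q n t :
  Tr_poly q n t %% ('X^(q ^ (2 * n) - 1) - 1) =
  P_poly q n t %% ('X^(q ^ (2 * n) - 1) - 1).
Proof. by rewrite /Tr_poly modp_id. Qed.

Lemma Tr_poly_min q n t g : (0 < q ^ (2 * n) - 1)%N ->
  g %% ('X^(q ^ (2 * n) - 1) - 1) =
  P_poly q n t %% ('X^(q ^ (2 * n) - 1) - 1) ->
  (size (Tr_poly q n t) <= size g)%N.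
Proof.
move=> N_gt0 eq_g; rewrite /Tr_poly -eq_g.
have nz : 'X^(q ^ (2 * n) - 1) - 1 != 0 :> {poly F}.
  by rewrite -size_poly_eq0 -polyC1 size_XnsubC.
have [lt_g|le_g] := ltnP (size g) (size ('X^(q ^ (2 * n) - 1) - 1 : {poly F})).
  by rewrite modp_small.
by apply: leq_trans (ltnW _) le_g; rewrite ltn_modp.
Qed.

End TraceDependingPolynomial.

Section CyclotomicCosets.
Variables r N : nat.

(* Cyclotomic coset of g in Z_N with respect to r, as a forward orbit; see
   mem_cyc_coset. Elements of 'Z_N coerce to their representatives in
   {0, ..., N - 1} (for N > 1). *)
Definition cyc_coset (g : 'Z_N) : {set 'Z_N} :=
  [set h | fconnect (fun x : 'Z_N => r%:R * x) g h].

Definition minimal_rep (g : 'Z_N) : bool :=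
  [forall h in cyc_coset g, (g <= h)%N].

Definition coset_union (g : nat -> 'Z_N) (tau : nat) : {set 'Z_N} :=
  \bigcup_(l < tau.+1) cyc_coset (g l).

Lemma mem_cyc_coset (g h : 'Z_N) : (1 < N)%N ->
  h \in cyc_coset g <-> exists i : nat, h = ((r ^ i * g) %% N)%N :> nat.
Proof.
move=> N_gt1.
have iterE i : iter i (fun x : 'Z_N => r%:R * x) g = (r ^ i * g)%N%:R.
  elim: i => [|i IHi]; first by rewrite expn0 mul1n natr_Zp.
  by rewrite iterS IHi expnS -mulnA [RHS]natrM.
have valE i : ((r ^ i * g)%N%:R : 'Z_N) = ((r ^ i * g) %% N)%N :> nat.
  exact: val_Zp_nat.
rewrite inE; split=> [/iter_findex <-|[i def_h]].
  by exists (findex (fun x : 'Z_N => r%:R * x) g h); rewrite iterE valE.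
have -> : h = iter i (fun x : 'Z_N => r%:R * x) g.
  by apply: val_inj; rewrite iterE /= [RHS]valE.
exact: fconnect_iter.
Qed.

End CyclotomicCosets.

Section EvaluationCodes.
Variables (F : finFieldType) (m : nat).

Definition ev (beta : 'I_m -> F) (h : {poly F}) : 'rV[F]_m :=
  \row_j h.[beta j].

Definition eval_code (N : nat) (beta : 'I_m -> F) (Gamma : {set 'Z_N}) :
    {vspace 'rV[F]_m} :=
  <<[seq ev beta 'X^i | i : 'Z_N in Gamma]>>%VS.

(* The subfield of F with Q elements (when F has one) is the set of fixed
   points of x |-> x ^ Q. *)
Definition in_subfield (Q : nat) : pred F := [pred x | x ^+ Q == x].

Definition subfield_words (Q : nat) : {set 'rV[F]_m} :=
  [set x : 'rV[F]_m | [forall j, in_subfield Q (x 0 j)]].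

Definition subfield_subcode (Q : nat) (E : {vspace 'rV[F]_m}) :
    {set 'rV[F]_m} :=
  [set x in subfield_words Q | x \in E].

(* Hermitian form and Hermitian dual over the subfield with Q ^ 2 elements. *)
Definition hermitian (Q : nat) (x y : 'rV[F]_m) : F :=
  \sum_j x 0 j * y 0 j ^+ Q.

Definition hermitian_dual (Q : nat) (C : {set 'rV[F]_m}) : {set 'rV[F]_m} :=
  [set x in subfield_words (Q ^ 2) | [forall y in C, hermitian Q x y == 0]].

Definition hermitian_self_orthogonal (Q : nat) (C : {set 'rV[F]_m}) : bool :=
  C \subset hermitian_dual Q C.

End EvaluationCodes.

Section StabilizerCodes.
(* K is the alphabet, a field with Q elements; the state space C^(Q^N) has its
   standard basis indexed by K^N. w is a primitive root of unity of order the
   characteristic of K. *)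
Variables (C : numClosedFieldType) (K : finFieldType) (w : C) (N : nat).

Definition fchar : nat := pdiv #|K|.

(* Absolute trace; it takes values in the prime subfield. *)
Definition abs_trace (x : K) : K :=
  \sum_(i < logn fchar #|K|) x ^+ (fchar ^ i).

(* The additive character w ^ (abs_trace x), where the exponent is the k < p
   such that abs_trace x = k%:R. *)
Definition chi (x : K) : C :=
  w ^+ index (abs_trace x) [seq k%:R | k <- iota 0 fchar].

Definition dot (b x : 'rV[K]_N) : K := \sum_i b 0 i * x 0 i.

Definition state : vectType C := {ffun 'rV[K]_N -> C^o}.

(* X(a)|x> = |x + a> and Z(b)|x> = chi (b . x) |x>, on coordinates. *)
Definition Xfun (a : 'rV[K]_N) (v : state) : state := [ffun x => v (x - a)].

Definition Zfun (b : 'rV[K]_N) (v : state) : state :=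
  [ffun x => chi (dot b x) *: v x].

Fact Xfun_is_linear a : linear (Xfun a).
Proof. by move=> c u v; apply/ffunP=> x; rewrite !ffunE. Qed.

Fact Zfun_is_linear b : linear (Zfun b).
Proof.
move=> c u v; apply/ffunP=> x.
by rewrite !ffunE scalerDr !scalerA [_ * c]mulrC.
Qed.

HB.instance Definition _ a :=
  GRing.isLinear.Build C state state *:%R (Xfun a) (Xfun_is_linear a).
HB.instance Definition _ b :=
  GRing.isLinear.Build C state state *:%R (Zfun b) (Zfun_is_linear b).

Definition XZ (a b : 'rV[K]_N) : 'End(state) :=
  (linfun (Xfun a) \o linfun (Zfun b))%VF.

Lemma XZE a b (v : state) x :
  XZ a b v x = chi (dot b (x - a)) * v (x - a).
Proof. by rewrite /XZ !lfunE /= !lfunE /= !ffunE. Qed.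

(* The phases are the p-th roots of unity for p odd. In characteristic 2 the
   standard error basis consists of the Hermitian Pauli operators (such as
   Y = iXZ), so the group it generates contains the scalar i. *)
Definition phase_order : nat := if fchar == 2%N then 4 else fchar.

Definition error_group (E : 'End(state)) : Prop :=
  exists (c : C) (a b : 'rV[K]_N), c ^+ phase_order = 1 /\ E = c *: XZ a b.

Definition abelian_error_subgroup (S : 'End(state) -> Prop) : Prop :=
  [/\ forall E, S E -> error_group E,
      S \1%VF,
      forall E E', S E -> S E' -> S (E \o E'^-1)%VF
    & forall E E', S E -> S E' -> (E \o E')%VF = (E' \o E)%VF].

Definition stabilizer_code (U : {vspace state}) : Prop :=
  U != 0%VS /\
  exists S, abelian_error_subgroup S /\
    forall v : state, v \in U <-> forall E, S E -> v \in passmx.leigenspace E 1.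

Definition inner (u v : state) : C := \sum_x (u x)^* * v x.

(* Number of positions on which X(a)Z(b) acts nontrivially. *)
Definition weight (a b : 'rV[K]_N) : nat :=
  #|[set i | (a 0 i != 0) || (b 0 i != 0)]|.

(* The error X(a)Z(b) is detected when P X(a)Z(b) P is a scalar multiple of P,
   P being the orthogonal projector onto U. One-dimensional codes satisfy this
   for every error; for them one requires, as usual, that every nontrivial
   detected error send U to an orthogonal space. *)
Definition detects (U : {vspace state}) (a b : 'rV[K]_N) : Prop :=
  (exists lambda : C, forall u v, u \in U -> v \in U ->
     inner u (XZ a b v) = lambda * inner u v) /\
  (\dim U = 1%N -> (0 < weight a b)%N ->
     forall u v, u \in U -> v \in U -> inner u (XZ a b v) = 0).

Definition minimum_distance (U : {vspace state}) (d : nat) : Prop :=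
  (forall a b, (weight a b < d)%N -> detects U a b) /\
  (exists a b, weight a b = d /\ ~ detects U a b).

(* U is an [[N, k, d]] stabilizer code over an alphabet of #|K| symbols. *)
Definition stabilizer_params (U : {vspace state}) (k d : nat) : Prop :=
  [/\ stabilizer_code U, \dim U = (#|K| ^ k)%N & minimum_distance U d].

End StabilizerCodes.

(* uphalf x is the ceiling of x / 2. *)
Definition A_bound (q n t : nat) : rat :=
  if q != 2%N then
    if (2 * t <= n)%N then
      q%:R ^+ n - (uphalf (q - 1))%:R * q%:R ^+ (n - 1)
        - (uphalf (q - 1))%:R * q%:R ^+ (n - t - 1) - 2
    else if (t < n)%N then
      q%:R ^+ n - (uphalf (q - 1))%:R * q%:R ^+ (n - 1)
        - (uphalf (q - 1))%:R * q%:R ^+ (t - 1) - 2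
    else q%:R ^+ (n - 1) - 2
  else if (t < n)%N then 2 ^+ n - 2 ^+ (t - 1) - 2
  else 2 ^+ (n - 1) - 2.

Definition B_bound (q n t : nat) : rat :=
  q%:R ^+ n - (q%:R - 1) * q%:R ^+ (n - t) - q%:R.

Definition B1_bound (q n t : nat) : rat :=
  q%:R ^+ n - (q%:R - 1) * q%:R ^+ (n - t) - 2.

Definition C_bound (q n : nat) : rat :=
  (q%:R ^+ (2 * n - 2) - 1) / (q%:R ^+ (n - 2) + 1).

Definition D_bound (q n t n' : nat) : rat :=
  if (1 < t)%N then
    if n' != 1%N then A_bound q n t
    else if ~~ odd n then B_bound q n t
    else Num.min (A_bound q n t) (B_bound q n t)
  else if n != 2%N then
    if (2 < n')%N then A_bound q n t
    else if n' == 2%N then C_bound q n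
    else B1_bound q n t
  else q%:R - 2.

(* Main.v *)
(* Write T(x) for the trace of x^(1+q^t) (to F_q, or from F_(q^n) if t = n); the
   beta_j are the x with 1 + T(x) = 0, and the indicator of this set is
   1 - (1+T)^(q-1). Expanding, the power sum of exponent E over the beta_j
   vanishes unless q^(2n)-1 divides E plus a sum of at most q-1 terms
   q^k + q^(k+t). Up to Frobenius the exponents occurring in the Hermitian
   products are g + q^L g' with g, g' <= D(q,t), 0 < L <= n, L = n' mod 2n'. For
   L < n (and for t = n) they are too small for the divisibility; for L = n it
   would force both halves of the sum to equal q^n - 1, but half of the total of
   the added terms is less than what the bound A(q,t) leaves free.

   The number m of roots matters: comparing T(y+z) with T(y) bounds the variance
   of the fibre sizes of T, and m far from the average q^(2n-1) forces n <= 2t.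
   Hence t = 1 only for n = 2, and the bounds C and B^1 never apply.

   For the quantum code: the evaluation code is stable under the Frobenius of
   F_(q^(2n')), so its reduced echelon basis lies in the subfield, and words
   orthogonal to it have weight > g_(tau+1) by Vandermonde. Writing
   F_(Q^2) = F_Q + gam F_Q turns the code into a symplectically isotropic D. The
   operators X(a)Z(b), (a,b) in D, commute; dividing each by its eigenvalue on a
   common eigenvector gives the stabilizer group, and the trace of the projector
   on its fixed space gives the dimension. *)

Require Import Defs.
From HB Require Import structures.
From mathcomp Require Import all_boot all_order all_algebra.
From mathcomp Require Import reals complex.
From mathcomp Require Import all_fingroup all_solvable all_field.
From mathcomp Require Import boolp zify ring lra.

Set Implicit Arguments.
Unset Strict Implicit.
Unset Printing Implicit Defensive.

Import Order.TTheory GRing.Theory Num.Theory.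

Local Open Scope ring_scope.

(** * Stabilizer codes from isotropic spaces *)

(** Matrices in a fixed basis reduce this to the common eigenvector of a commuting family of square
    matrices over an algebraically closed field. *)
Lemma common_eigenvector_lfun (C : numClosedFieldType) (vT : vectType C)
    (fs : seq 'End(vT)) :
  (0 < \dim {:vT})%N ->
  {in fs &, forall f g : 'End(vT), (f \o g)%VF = (g \o f)%VF} ->
  exists2 v : vT, v != 0 & {in fs, forall f : 'End(vT), exists a, f v = a *: v}.
Proof.
move=> dim_gt0 fsC.
pose e := vbasis {:vT}; have eB : basis_of {:vT} e := vbasisP _.
have [|x x_neq0 /allP xP] :=
  @spectral.common_eigenvector C _ [seq passmx.mxof e e f | f <- fs] dim_gt0.
  move=> _ _ /mapP[f f_in ->] /mapP[g g_in ->].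
  by rewrite /comm_mx -!(passmx.mxof_comp e e eB) fsC.
exists (passmx.vecof e x); first by rewrite passmx.vecof_eq0.
move=> f f_in; have /xP/eigenvectorP[a /eigenspaceP xa] :
  passmx.mxof e e f \in [seq passmx.mxof e e f | f <- fs] by apply: map_f.
exists a; rewrite (passmx.hom_vecof e eB) xa /passmx.vecof scaler_sumr.
by apply: eq_bigr => i _; rewrite mxE scalerA.
Qed.

(** * Additive characters of a finite field *)

Section AdditiveCharacter.
Variables (C : numClosedFieldType) (K : finFieldType) (w : C) (p k : nat).
Hypotheses (p_prime : prime p) (k_gt0 : (0 < k)%N) (cardK : #|K| = (p ^ k)%N).
Hypothesis w_prim : p.-primitive_root w.

Lemma fcharE : fchar K = p.
Proof. by rewrite /fchar cardK -(prednK k_gt0) pdiv_pfactor. Qed.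

Lemma pcharK : p \in [pchar K]. Proof. exact: card_finPcharP cardK p_prime. Qed.

Lemma abs_traceE (x : K) : abs_trace x = \sum_(i < k) x ^+ (p ^ i).
Proof. by rewrite /abs_trace fcharE cardK pfactorK. Qed.

Lemma abs_traceD (x y : K) : abs_trace (x + y) = abs_trace x + abs_trace y.
Proof.
rewrite !abs_traceE -big_split /=; apply: eq_bigr => i _.
by rewrite exprDn_pchar // pnatX pnatE // pcharK.
Qed.

Lemma abs_trace_frob (x : K) : abs_trace x ^+ p = abs_trace x.
Proof.
have frobE (z : K) : z ^+ p = pFrobenius_aut pcharK z by [].
rewrite abs_traceE frobE rmorph_sum /=.
rewrite (eq_bigr (fun i : 'I_k => x ^+ (p ^ i.+1))); last first.
  by move=> i _; rewrite -frobE -exprM expnSr.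
rewrite -(prednK k_gt0) big_ord_recr big_ord_recl /= prednK //.
by rewrite -cardK expf_card expr1 addrC.
Qed.

Lemma natr_eq_mod (i j : nat) : i%:R = j%:R :> K -> i = j %[mod p].
Proof.
wlog le_ij : i j / (i <= j)%N.
  move=> H; case/orP: (leq_total i j) => le_ij; first exact: H.
  by move/esym=> eq_ij; apply/esym; apply: H.
move/eqP; rewrite eq_sym -subr_eq0 -natrB // -(dvdn_pcharf pcharK) => dvd_p.
by apply/esym/eqP; rewrite eqn_mod_dvd.
Qed.

(** X^p - X has at most p roots, and the naturals below p already give p distinct ones. *)
Lemma frob_fixed_natr (x : K) : x ^+ p = x -> x \in [seq i%:R | i <- iota 0 p].
Proof.
move=> xp; set s := map _ _.
have s_uniq : uniq s.
  rewrite map_inj_in_uniq ?iota_uniq // => i j; rewrite !mem_iota !add0n.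
  by move=> /= lt_ip lt_jp /natr_eq_mod; rewrite !modn_small.
have s_frob : all (root ('X^p - 'X)) s.
  apply/allP=> _ /mapP[i _ ->]; rewrite rootE !hornerE subr_eq0.
  by rewrite -[_ ^+ p]/(pFrobenius_aut pcharK i%:R) rmorph_nat.
apply: contraTT isT => x_notin; exfalso.
have /max_poly_roots : 'X^p - 'X != 0 :> {poly K}.
  rewrite -size_poly_eq0 size_polyDl ?size_polyXn //.
  by rewrite size_polyN size_polyX ltnS prime_gt1.
move=> /(_ (x :: s)) /=; rewrite s_frob x_notin s_uniq rootE !hornerE xp subrr eqxx.
move=> /(_ isT isT); rewrite size_map size_iota size_polyDl ?size_polyXn ?ltnn //.
by rewrite size_polyN size_polyX ltnS prime_gt1.
Qed.

(** As [w] has order [p], any natural number representing the trace can serve as exponent, not only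
    the index chosen in [chi]. *)
Lemma chi_natr (x : K) (i : nat) : abs_trace x = i%:R -> chi w x = w ^+ i.
Proof.
move=> xi; rewrite /chi fcharE; set s := map _ _.
have xs : abs_trace x \in s by apply/frob_fixed_natr/abs_trace_frob.
have lt_s : (index (abs_trace x) s < p)%N.
  by move: xs; rewrite -index_mem size_map size_iota.
have := nth_index 0 xs; rewrite (nth_map 0%N) ?size_iota // nth_iota // add0n xi.
move=> /natr_eq_mod eq_mod; apply/eqP; rewrite (eq_prim_root_expr w_prim).
exact/eqP.
Qed.

Lemma abs_trace_natr (x : K) : exists i : nat, abs_trace x = i%:R.
Proof.
by have /mapP[i _ ->] := frob_fixed_natr (abs_trace_frob x); exists i.
Qed.

Lemma chiD (x y : K) : chi w (x + y) = chi w x * chi w y.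
Proof.
have [[i xi] [j yj]] := (abs_trace_natr x, abs_trace_natr y).
rewrite (chi_natr xi) (chi_natr yj) -exprD; apply: chi_natr.
by rewrite abs_traceD xi yj natrD.
Qed.

Lemma chi0 : chi w (0 : K) = 1.
Proof.
rewrite (@chi_natr 0 0) ?expr0 // abs_traceE big1 // => i _.
by rewrite expr0n expn_eq0 -leqn0 leqNgt prime_gt0.
Qed.

Lemma chiX (x : K) n : chi w (x *+ n) = chi w x ^+ n.
Proof.
elim: n => [|n IHn]; first by rewrite mulr0n chi0.
by rewrite mulrS chiD IHn exprS.
Qed.

Lemma chiXp (x : K) : chi w x ^+ p = 1.
Proof. by rewrite -chiX -mulr_natr pcharf0 ?pcharK // mulr0 chi0. Qed.

Lemma chi_neq0 (x : K) : chi w x != 0.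
Proof.
apply/eqP => x0; have /eqP := chiXp x.
by rewrite x0 expr0n -leqn0 leqNgt prime_gt0 // eq_sym oner_eq0.
Qed.

Lemma chi_norm (x : K) : `|chi w x| = 1.
Proof.
apply/eqP; rewrite -(@pexpr_eq1 _ _ p) ?prime_gt0 //.
by rewrite -normrX chiXp normr1.
Qed.

Lemma chi_conj (x : K) : (chi w x)^* = (chi w x)^-1.
Proof.
apply: (mulfI (chi_neq0 x)); rewrite divff ?chi_neq0 //.
by rewrite -normCK chi_norm expr1n.
Qed.

(** The trace is a nonzero polynomial of degree at most p^(k-1) < [#|K|], so it cannot vanish on all
    of [K]. *)
Lemma chi_nontrivial : exists x : K, chi w x != 1.
Proof.
suff [x x_neq0] : exists x : K, abs_trace x != 0.
  exists x; have [i xi] := abs_trace_natr x; rewrite (chi_natr xi).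
  rewrite -(prim_order_dvd w_prim) (dvdn_pcharf pcharK).
  by rewrite -xi.
apply/existsP; apply: contraTT isT; rewrite negb_exists => /forallP tr0.
pose P : {poly K} := \sum_(i < k) 'X^(p ^ i).
have rootsP : all (root P) (enum K).
  apply/allP=> x _; rewrite rootE horner_sum -[X in X == 0](_ : abs_trace x = _).
    by have := tr0 x; rewrite negbK.
  by rewrite abs_traceE; apply: eq_bigr => i _; rewrite hornerXn.
have sizeP : (size P <= p ^ k.-1 + 1)%N.
  apply: (leq_trans (size_sum _ _ _)); apply/bigmax_leqP => i _.
  rewrite size_polyXn addn1 ltnS leq_exp2l ?prime_gt1 //.
  by rewrite -ltnS (ltn_predK k_gt0).
have P_neq0 : P != 0.
  apply/eqP => /(congr1 (fun Q : {poly K} => Q`_1)) /eqP; apply/negP.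
  rewrite coef0 coef_sum -(prednK k_gt0) big_ord_recl expn0 coefX eqxx.
  rewrite big1 ?addr0 ?oner_eq0 //.
  move=> i _; rewrite coefXn -(expn0 p) eqn_exp2l ?prime_gt1 //.
have := max_poly_roots P_neq0 rootsP (enum_uniq K).
rewrite -cardE cardK => /leq_trans/(_ sizeP).
rewrite -(prednK k_gt0) expnS /=; have := prime_gt1 p_prime.
have : (0 < p ^ k.-1)%N by rewrite expn_gt0 prime_gt0.
nia.
Qed.

Lemma sum_chi (x : K) : x != 0 -> \sum_(y : K) chi w (y * x) = 0.
Proof.
move=> x_neq0; have [z z_neq1] := chi_nontrivial.
apply: (mulfI (_ : chi w z - 1 != 0)); first by rewrite subr_eq0.
rewrite mulr0 mulrBl mul1r mulr_sumr; apply/eqP; rewrite subr_eq0; apply/eqP.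
rewrite [RHS](reindex_inj (addrI (z / x))) /=; apply: eq_bigr => y _.
by rewrite mulrDl divfK // chiD.
Qed.

End AdditiveCharacter.

Section Dot.
Variables (K : finFieldType) (N : nat).
Implicit Types a b : 'rV[K]_N.

Lemma dotDl a b c : dot (a + b) c = dot a c + dot b c.
Proof.
by rewrite /dot -big_split /=; apply: eq_bigr => i _; rewrite mxE mulrDl.
Qed.

Lemma dotC a b : dot a b = dot b a.
Proof. by apply: eq_bigr => i _; rewrite mulrC. Qed.

Lemma dotDr a b c : dot a (b + c) = dot a b + dot a c.
Proof. by rewrite !(dotC a) dotDl. Qed.

Lemma dotZl k a b : dot (k *: a) b = k * dot a b.
Proof. by rewrite /dot mulr_sumr; apply: eq_bigr => i _; rewrite mxE mulrA. Qed.

Lemma dotZr k a b : dot a (k *: b) = k * dot a b.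
Proof. by rewrite dotC dotZl dotC. Qed.

Lemma dotNl a b : dot (- a) b = - dot a b.
Proof. by rewrite -scaleN1r dotZl mulN1r. Qed.

Lemma dotNr a b : dot a (- b) = - dot a b.
Proof. by rewrite dotC dotNl dotC. Qed.

Lemma dot0l b : dot 0 b = 0.
Proof. by rewrite -(scale0r 0) dotZl mul0r. Qed.

Lemma dot_delta a i k : dot a (k *: delta_mx 0 i) = a 0 i * k.
Proof.
rewrite dotZr mulrC /dot (bigD1 i) //= mxE !eqxx mulr1 big1 ?addr0 //.
by move=> j ji; rewrite mxE (negPf ji) andbF mulr0.
Qed.

Lemma weight_eq0 a b : weight a b = 0%N -> (a = 0) * (b = 0).
Proof.
move/cards0_eq/setP => ab0.
have {}ab0 i : (a 0 i == 0) && (b 0 i == 0).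
  by have := ab0 i; rewrite !inE => /negbT; rewrite negb_or !negbK.
by split; apply/rowP=> i; rewrite mxE; have /andP[/eqP ? /eqP ?] := ab0 i.
Qed.

End Dot.

(** * Inner product and trace on the state space *)

Section Inner.
Variables (C : numClosedFieldType) (K : finFieldType) (N : nat).
Implicit Types u v : state C K N.

Lemma innerZl c u v : inner (c *: u) v = c^* * inner u v.
Proof.
rewrite /inner mulr_sumr; apply: eq_bigr => x _.
by rewrite ffunE rmorphM mulrA.
Qed.

Lemma innerZr c u v : inner u (c *: v) = c * inner u v.
Proof.
rewrite /inner mulr_sumr; apply: eq_bigr => x _.
by rewrite ffunE /= mulrCA.
Qed.

Lemma innerBr u v v' : inner u (v - v') = inner u v - inner u v'.
Proof.
rewrite /inner -sumrB; apply: eq_bigr => x _.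
by rewrite !ffunE mulrBr.
Qed.

Lemma inner_eq0 u : (inner u u == 0) = (u == 0).
Proof.
apply/eqP/eqP => [/psumr_eq0P u0|->]; last first.
  by rewrite /inner big1 // => x _; rewrite ffunE mulr0.
apply/ffunP => x; rewrite ffunE; apply/eqP.
have u_ge0 y : true -> 0 <= (u y)^* * u y by rewrite mulrC -normCK exprn_ge0.
by have /eqP := u0 u_ge0 x isT; rewrite mulrC -normCK sqrf_eq0 normr_eq0.
Qed.

Definition basis_state (x : 'rV[K]_N) : state C K N := [ffun y => (y == x)%:R].

Lemma state_sum v : v = \sum_x v x *: basis_state x.
Proof.
apply/ffunP => y; rewrite sum_ffunE.
rewrite (eq_bigr (fun x => v x * (y == x)%:R)); last first.
  by move=> x _; rewrite ffunE [basis_state x y]ffunE.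
rewrite (bigD1 y) //= eqxx mulr1 big1 ?addr0 // => x xy.
by rewrite eq_sym (negPf xy) mulr0.
Qed.

(* The trace of a projector is computed on the basis of its image. *)
Lemma trace_projector (P : 'End(state C K N)) : (P \o P = P)%VF ->
  (\dim (limg P))%:R = \sum_x P (basis_state x) x.
Proof.
move=> PP; pose b := vbasis (limg P).
have Pb v : P v = \sum_i coord b i (P v) *: b`_i.
  by apply: coord_vbasis; rewrite memv_img ?memvf.
rewrite (eq_bigr (fun x => \sum_i coord b i (P (basis_state x)) * b`_i x)); last first.
  by move=> x _; rewrite {1}Pb sum_ffunE; apply: eq_bigr => i _; rewrite ffunE.
rewrite exchange_big /=.
rewrite (eq_bigr (fun=> 1)) ?sumr_const ?card_ord // => i _.
(* Expanding the i-th basis vector over the basis states turns the sum over [x] into the i-th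
   coordinate of its image under [P]; this is 1, as [P] fixes its image. *)
transitivity (coord b i (P b`_i)).
  rewrite [b`_i in RHS]state_sum !linear_sum; apply: eq_bigr => x _.
  by rewrite !linearZ /= mulrC.
have /memv_imgP[v _ bv] : b`_i \in limg P.
  by apply: vbasis_mem; rewrite mem_nth ?size_tuple.
rewrite bv -comp_lfunE PP -bv coord_free ?eqxx //.
exact: basis_free (vbasisP _).
Qed.

End Inner.

(** * The operators X(a)Z(b) *)

Section Operators.
Variables (C : numClosedFieldType) (K : finFieldType) (w : C) (p k N : nat).
Hypotheses (p_prime : prime p) (k_gt0 : (0 < k)%N) (cardK : #|K| = (p ^ k)%N).
Hypothesis w_prim : p.-primitive_root w.

Local Notation XZ := (@XZ C K w N).
Local Notation chi := (@chi C K w).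
Local Notation chiD := (chiD p_prime k_gt0 cardK w_prim).
Local Notation chi0 := (chi0 p_prime k_gt0 cardK w_prim).
Local Notation chi_conj := (chi_conj p_prime k_gt0 cardK w_prim).
Local Notation chi_neq0 := (chi_neq0 p_prime k_gt0 cardK w_prim).
Local Notation sum_chi := (sum_chi p_prime k_gt0 cardK w_prim).

(** Moving Z(b) past X(a') costs the phase [chi (dot b a')]. *)
Lemma XZ_comp a b a' b' :
  (XZ a b \o XZ a' b')%VF = chi (dot b a') *: XZ (a + a') (b + b').
Proof.
apply/lfunP => v; apply/ffunP => x.
rewrite comp_lfunE !XZE scale_lfunE ffunE XZE /GRing.scale /= opprD !addrA mulrA mulrA.
congr (_ * _); rewrite -!chiD; congr (chi _).
by rewrite dotDl !dotDr !dotNr; ring.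
Qed.

Lemma XZ0 : XZ 0 0 = \1%VF.
Proof.
apply/lfunP => v; apply/ffunP => x.
by rewrite XZE id_lfunE dot0l chi0 subr0 mul1r.
Qed.

Lemma inner_XZ a b u v : inner (XZ a b u) (XZ a b v) = inner u v.
Proof.
rewrite /inner (reindex_inj (addIr a)) /=; apply: eq_bigr => x _.
rewrite !XZE !addrK rmorphM mulrACA /= chi_conj mulVf ?chi_neq0 //.
exact: mul1r.
Qed.

Lemma sum_chi_dot (b : 'rV[K]_N) : b != 0 -> \sum_x chi (dot b x) = 0.
Proof.
move=> b_neq0.
have [z z_neq1] := chi_nontrivial p_prime k_gt0 cardK w_prim.
have [i bi] : exists i, b 0 i != 0.
  apply/existsP; apply: contraNT b_neq0; rewrite negb_exists => /forallP b0.
  by apply/eqP/rowP => i; rewrite mxE; apply/eqP; rewrite -[_ == _]negbK.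
pose y : 'rV[K]_N := (z / b 0 i) *: delta_mx 0 i.
apply: (mulfI (_ : chi z - 1 != 0)); first by rewrite subr_eq0.
rewrite mulr0 mulrBl mul1r mulr_sumr; apply/eqP; rewrite subr_eq0; apply/eqP.
rewrite [RHS](reindex_inj (addrI y)) /=; apply: eq_bigr => x _.
by rewrite dotDr chiD dot_delta mulrCA divff // mulr1.
Qed.

(** For a nonzero, every basis state is moved off the diagonal; for a = 0 the diagonal is a
    character sum, which vanishes unless b = 0. *)
Lemma trace_XZ a b :
  \sum_x XZ a b (basis_state C x) x = (if (a, b) == 0 then (#|K| ^ N)%N else 0%N)%:R.
Proof.
rewrite -[(a, b) == 0]/((a == 0) && (b == 0)).
have [->|a_neq0] := eqVneq a 0; last first.
  apply: big1 => x _; rewrite XZE ffunE.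
  by rewrite -subr_eq0 addrAC subrr add0r oppr_eq0 (negPf a_neq0) mulr0.
rewrite (eq_bigr (fun x => chi (dot b x))); last first.
  by move=> x _; rewrite XZE subr0 ffunE eqxx mulr1.
have [->|b_neq0] := eqVneq b 0; last exact: sum_chi_dot.
rewrite (eq_bigr (fun=> 1)); last by move=> x _; rewrite dot0l chi0.
by rewrite sumr_const card_mx mul1n.
Qed.

Lemma orthogonal_pair (U : {vspace state C K N}) : (1 < \dim U)%N ->
  exists u v, [/\ u \in U, v \in U, u != 0, v != 0 & inner u v = 0].
Proof.
move=> dimU; pose b := vbasis U; have bB : basis_of U b := vbasisP U.
pose x := b`_0; pose y := b`_1.
have [xU yU] : x \in U /\ y \in U.
  by split; apply: vbasis_mem; rewrite mem_nth ?size_tuple // ltnW.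
have x_neq0 : x != 0.
  apply: (free_not0 (basis_free bB)).
  by rewrite mem_nth // size_tuple ltnW.
have y_free c : y - c *: x != 0.
  rewrite subr_eq0; apply/eqP => yx.
  have x1 : coord b (Ordinal dimU) x = 0.
    exact: (coord_free (Ordinal (ltnW dimU)) (Ordinal dimU) (basis_free bB)).
  have y1 : coord b (Ordinal dimU) y = 1.
    rewrite [LHS](coord_free (Ordinal dimU) (Ordinal dimU) (basis_free bB)).
    by rewrite eqxx.
  by move/eqP: y1; rewrite yx linearZ /= x1 mulr0 eq_sym oner_eq0.
(* One Gram-Schmidt step on the first two basis vectors. *)
exists x, (y - (inner x y / inner x x) *: x); split=> //.
  by rewrite memvB ?memvZ.
by rewrite innerBr innerZr divfK ?subrr // inner_eq0.
Qed.

(* The operators X(a)Z(b) span all matrix units, so they cannot all act as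
   scalars on a code of dimension at least two. *)
Lemma undetected_exists (U : {vspace state C K N}) :
  (1 < \dim U)%N -> exists a b, ~ detects w U a b.
Proof.
move=> dimU; apply: contrapT => no_err.
have det a b : detects w U a b by apply: contrapT => nd; apply: no_err; exists a, b.
have [u [v [uU vU u_neq0 v_neq0 uv]]] := orthogonal_pair dimU.
have uXZv a b : inner u (XZ a b v) = 0.
  by have [[l /(_ u v uU vU) ->] _] := det a b; rewrite uv mulr0.
(* Fourier inversion over [b]: with weights [chi (- dot b y)], the operators [XZ (x - y) b] add up
   to [#|K| ^ N] times the matrix unit sending the basis state of [y] to that of [x]. *)
have uv0 x y : (u x)^* * v y = 0.
  have : \sum_b chi (- dot b y) * inner u (XZ (x - y) b v) = 0.
    by apply: big1 => b _; rewrite uXZv mulr0.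
  rewrite (eq_bigr (fun b =>
      \sum_z (u z)^* * v (z - (x - y)) * chi (dot (z - x) b))); last first.
    move=> b _; rewrite mulr_sumr; apply: eq_bigr => z _.
    rewrite XZE mulrCA -mulrA; congr (_ * _).
    rewrite mulrA [RHS]mulrC -chiD; congr (chi _ * _).
    by rewrite [RHS]dotC !(dotDr, dotNr); ring.
  rewrite exchange_big /= (bigD1 x) //= [X in _ + X]big1 ?addr0.
    rewrite -mulr_sumr subrr opprB addrC subrK.
    rewrite (eq_bigr (fun=> 1)); last by move=> b _; rewrite dot0l chi0.
    rewrite sumr_const => /eqP; rewrite mulf_eq0 pnatr_eq0 orbC -leqn0 leqNgt.
    by rewrite card_mx expn_gt0 cardK expn_gt0 prime_gt0 //= => /eqP.
  by move=> z zx; rewrite -mulr_sumr sum_chi_dot ?mulr0 // subr_eq0.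
have [x ux] : exists x, u x != 0.
  apply/existsP; apply: contraNT u_neq0; rewrite negb_exists => /forallP u0.
  by apply/eqP/ffunP => x; rewrite ffunE; apply/eqP; rewrite -[_ == _]negbK.
have /eqP[] : v != 0 by [].
apply/ffunP => y; rewrite ffunE; have /eqP := uv0 x y.
by rewrite mulf_eq0 conjC_eq0 (negPf ux) => /eqP.
Qed.

End Operators.

(** * Stabilizer group and code of an isotropic set *)

Section StabilizerOfIsotropic.
Variables (C : numClosedFieldType) (K : finFieldType) (w : C) (p k N : nat).
Hypotheses (p_prime : prime p) (k_gt0 : (0 < k)%N) (cardK : #|K| = (p ^ k)%N).
Hypothesis w_prim : p.-primitive_root w.

Local Notation V := ('rV[K]_N * 'rV[K]_N)%type.
Local Notation XZ := (@XZ C K w N).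
Local Notation chi := (@chi C K w).

(** The operators [XZ] at [u] and at [v] commute up to the phase [chi (symp u v)]. *)
Definition symp (u v : V) : K := dot u.2 v.1 - dot v.2 u.1.

Lemma sympZl c u v : symp (c *: u) v = c * symp u v.
Proof. by rewrite /symp /= dotZl dotZr -mulrBr. Qed.

Variable D : {set V}.
Hypothesis D_lin : forall c u v, u \in D -> v \in D -> c *: u + v \in D.
Hypothesis D0 : 0 \in D.
Hypothesis D_iso : forall u v, u \in D -> v \in D -> symp u v = 0.

Let D_add u v : u \in D -> v \in D -> u + v \in D.
Proof. by move=> uD vD; rewrite -(scale1r u) D_lin. Qed.

Let D_opp u : u \in D -> - u \in D.
Proof. by move=> uD; rewrite -(addr0 (- u)) -scaleN1r D_lin. Qed.

Let XZcomm (u v : V) : u \in D -> v \in D ->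
  (XZ u.1 u.2 \o XZ v.1 v.2)%VF = (XZ v.1 v.2 \o XZ u.1 u.2)%VF.
Proof.
move=> uD vD; rewrite !(XZ_comp p_prime k_gt0 cardK w_prim).
by have /eqP := D_iso uD vD; rewrite subr_eq0 => /eqP ->; rewrite !(addrC v.1, addrC v.2).
Qed.

(* The eigenvalues of a common eigenvector provide phases for which the
   operators indexed by D form a group. *)
Lemma phases_exist : exists lam : V -> C,
  [/\ lam 0 = 1, forall u, u \in D -> lam u != 0
    & forall u v, u \in D -> v \in D ->
        lam u * lam v = chi (dot u.2 v.1) * lam (u + v)].
Proof.
have dim_gt0 : (0 < \dim {: state C K N})%N.
  rewrite lt0n dimv_eq0; apply/eqP => full0.
  have : basis_state C 0 \in (0%VS : {vspace state C K N}) by rewrite -full0 memvf.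
  rewrite memv0 => /eqP/ffunP/(_ 0); rewrite !ffunE eqxx => /eqP.
  by rewrite oner_eq0.
have [] := @common_eigenvector_lfun C (state C K N)
    [seq XZ u.1 u.2 | u <- enum D] dim_gt0.
  move=> _ _ /mapP[u uD ->] /mapP[v vD ->].
  by rewrite XZcomm // -mem_enum.
move=> s s_neq0 s_eig.
have [x sx] : exists x, s x != 0.
  apply/existsP; apply: contraNT s_neq0; rewrite negb_exists => /forallP s0.
  by apply/eqP/ffunP => x; rewrite ffunE; apply/eqP; rewrite -[_ == _]negbK.
pose lam (u : V) := XZ u.1 u.2 s x / s x.
have lamP u : u \in D -> XZ u.1 u.2 s = lam u *: s.
  move=> uD; have [|a sa] := s_eig (XZ u.1 u.2).
    by apply/mapP; exists u; rewrite ?mem_enum.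
  rewrite /lam sa ffunE; congr (_ *: _).
  by rewrite /GRing.scale /= mulfK.
have lam0 : lam 0 = 1 by rewrite /lam (XZ0 N p_prime k_gt0 cardK w_prim) id_lfunE divff.
have lamM u v : u \in D -> v \in D ->
    lam u * lam v = chi (dot u.2 v.1) * lam (u + v).
  move=> uD vD.
  have /lfunP/(_ s) := XZ_comp p_prime k_gt0 cardK w_prim u.1 u.2 v.1 v.2.
  rewrite comp_lfunE lamP // linearZ /= lamP // scale_lfunE.
  rewrite -[XZ _ _]/(XZ (u + v).1 (u + v).2) lamP ?D_add // !scalerA.
  move=> /ffunP/(_ x); rewrite !ffunE => /(mulIf sx) <-.
  by rewrite mulrC.
exists lam; split=> // u uD; apply/eqP => u0.
have /eqP := lamM u (- u) uD (D_opp uD).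
rewrite u0 mul0r subrr lam0 mulr1 eq_sym.
by rewrite (negPf (chi_neq0 p_prime k_gt0 cardK w_prim _)).
Qed.

Variable lam : V -> C.
Hypothesis lam0 : lam 0 = 1.
Hypothesis lam_neq0 : forall u, u \in D -> lam u != 0.
Hypothesis lamM : forall u v, u \in D -> v \in D ->
  lam u * lam v = chi (dot u.2 v.1) * lam (u + v).

(** Dividing by [lam] absorbs the phase in [XZ_comp], so that sums in [D] become compositions. *)
Definition stab_op (u : V) : 'End(state C K N) := (lam u)^-1 *: XZ u.1 u.2.

Lemma stab_op_comp u v : u \in D -> v \in D ->
  (stab_op u \o stab_op v)%VF = stab_op (u + v).
Proof.
move=> uD vD; rewrite /stab_op -comp_lfunZl -comp_lfunZr scalerA.
rewrite (XZ_comp p_prime k_gt0 cardK w_prim) scalerA; congr (_ *: _).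
have luv := lam_neq0 (D_add uD vD).
have -> : chi (dot u.2 v.1) = lam u * lam v / lam (u + v).
  by rewrite lamM // mulfK.
by field; rewrite luv !lam_neq0.
Qed.

Lemma stab_op0 : stab_op 0 = \1%VF.
Proof.
by rewrite /stab_op lam0 invr1 scale1r (XZ0 N p_prime k_gt0 cardK w_prim).
Qed.

(** The average over the group, hence the projector onto the common fixed space. *)
Definition stab_proj : 'End(state C K N) :=
  (#|D|%:R)^-1 *: \sum_(u in D) stab_op u.

Definition stab_space : {vspace state C K N} := limg stab_proj.

Lemma stab_op_proj u : u \in D -> (stab_op u \o stab_proj = stab_proj)%VF.
Proof.
move=> uD; rewrite /stab_proj -comp_lfunZr; congr (_ *: _).
apply/lfunP => s; rewrite comp_lfunE !sum_lfunE linear_sum /=.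
rewrite [RHS](reindex_inj (addrI u)) /=.
apply: eq_big => [v|v vD]; last by rewrite -stab_op_comp // comp_lfunE.
apply/idP/idP => [vD|/(D_add (D_opp uD))]; first exact: D_add.
by rewrite addKr.
Qed.

Lemma cardD_neq0 : #|D|%:R != 0 :> C.
Proof. by rewrite pnatr_eq0 -lt0n; apply/card_gt0P; exists 0. Qed.

Lemma mem_stab_space v :
  v \in stab_space <-> forall u, u \in D -> stab_op u v = v.
Proof.
split=> [/memv_imgP[s _ ->] u uD|v_fix].
  by rewrite -comp_lfunE stab_op_proj.
apply/memv_imgP; exists v; rewrite ?memvf // /stab_proj scale_lfunE sum_lfunE.
rewrite (eq_bigr (fun=> v)) // sumr_const -scaler_nat scalerA.
by rewrite mulVf ?cardD_neq0 ?scale1r.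
Qed.

Lemma stab_projK : (stab_proj \o stab_proj = stab_proj)%VF.
Proof.
apply/lfunP => v; rewrite comp_lfunE; set s := stab_proj v.
have /mem_stab_space s_fix : s \in stab_space by rewrite memv_img ?memvf.
rewrite /stab_proj scale_lfunE sum_lfunE.
rewrite (eq_bigr (fun=> s)) // sumr_const -scaler_nat scalerA.
by rewrite mulVf ?cardD_neq0 ?scale1r.
Qed.

(** The dimension is the trace of [stab_proj], to which only the operator at 0 contributes. *)
Lemma dim_stab_space : (\dim stab_space * #|D| = #|K| ^ N)%N.
Proof.
apply/eqP; rewrite -(eqr_nat C) natrM /stab_space trace_projector ?stab_projK //.
rewrite mulrC /stab_proj mulr_sumr.
rewrite (eq_bigr (fun x => \sum_(u in D) (lam u)^-1 * XZ u.1 u.2 (basis_state C x) x)).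
  rewrite exchange_big /= (bigD1 (0 : V)) //= -mulr_sumr lam0 invr1 mul1r.
  rewrite (trace_XZ p_prime k_gt0 cardK w_prim) eqxx big1 ?addr0 // => u /andP[_ u_neq0].
  rewrite -mulr_sumr (trace_XZ p_prime k_gt0 cardK w_prim) -surjective_pairing.
  by rewrite (negPf u_neq0) mulr0.
move=> x _; rewrite scale_lfunE ffunE sum_lfunE sum_ffunE /GRing.scale /=.
rewrite mulrA divff ?cardD_neq0 // mul1r; apply: eq_bigr => u _.
by rewrite scale_lfunE ffunE.
Qed.

(** Adding [u] to [u *+ i] contributes the phase [chi (dot u.2 u.1)] to the power i; these exponents
    sum to the binomial coefficient. *)
Lemma lamX u n : u \in D ->
  u *+ n \in D /\ lam u ^+ n = chi (dot u.2 u.1) ^+ 'C(n, 2) * lam (u *+ n).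
Proof.
move=> uD; elim: n => [|n [unD IHn]].
  by rewrite mulr0n D0 bin0n expr0 mul1r lam0.
split; first by rewrite mulrS D_add.
rewrite exprSr IHn -mulrA lamM // mulrA -[u *+ n + u]mulrSr; congr (_ * _).
have -> : dot (u *+ n).2 u.1 = dot u.2 u.1 *+ n.
  rewrite -[in LHS]scaler_nat -[RHS]mulr_natl.
  by rewrite -dotZl; congr (dot _ _); rewrite -[in LHS]scaler_nat.
rewrite (chiX p_prime k_gt0 cardK w_prim) -exprD binS bin1 addnC; congr (_ ^+ _).
Qed.

(** Since [u *+ p] is 0, [lam u ^+ p] is a p-th root of unity raised to C(p, 2). For odd p this
    exponent is a multiple of p; for p = 2 it is 1, so that [lam u ^+ 2] is a sign and the order is
    4. *)
Lemma lam_phase u : u \in D -> (lam u)^-1 ^+ phase_order K = 1.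
Proof.
move=> uD; rewrite exprVn; apply/eqP; rewrite invr_eq1; apply/eqP.
have pchar0 : u *+ p = 0.
  by rewrite -(scaler_nat p u) pcharf0 ?scale0r // (pcharK _ cardK).
have lamp : lam u ^+ p = chi (dot u.2 u.1) ^+ 'C(p, 2).
  by have [_ ->] := lamX p uD; rewrite pchar0 lam0 mulr1.
have chip := chiXp p_prime k_gt0 cardK w_prim (dot u.2 u.1).
rewrite /phase_order (fcharE p_prime k_gt0 cardK); case: eqVneq => [p2|p_neq2].
  have -> : 4 = (p * 2)%N by rewrite p2.
  by rewrite exprM lamp p2 bin2 /= expr1 -p2.
rewrite lamp bin2odd; last by case: (even_prime p_prime) => // p2; rewrite p2 in p_neq2.
by rewrite exprM chip expr1n.
Qed.

Lemma stab_space_stabilizer : stabilizer_code w stab_space.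
Proof.
split.
  apply/eqP => U0; have := dim_stab_space; rewrite U0 dimv0 mul0n => /esym/eqP.
  by apply/negP; rewrite -lt0n expn_gt0 cardK expn_gt0 prime_gt0.
exists (fun E => exists2 u, u \in D & E = stab_op u); split; last first.
  move=> v; rewrite mem_stab_space; split=> [v_fix E [u uD ->]|v_fix u uD].
    by rewrite memv_ker scale1r add_lfunE opp_lfunE id_lfunE v_fix // subrr.
  have : v \in passmx.leigenspace (stab_op u) 1 by apply: v_fix; exists u.
  by rewrite memv_ker scale1r add_lfunE opp_lfunE id_lfunE subr_eq0 => /eqP.
split.
- by move=> E [u uD ->]; exists (lam u)^-1, u.1, u.2; rewrite lam_phase.
- by exists 0; rewrite ?stab_op0.
- move=> _ _ [u uD ->] [v vD ->]; exists (u - v); first by rewrite D_add ?D_opp.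
  have vNv : (stab_op (- v) \o stab_op v)%VF = \1%VF.
    by rewrite stab_op_comp ?D_opp // addNr stab_op0.
  have ker0 : lker (stab_op v) == 0%VS.
    apply/lker0P => x y /(congr1 (stab_op (- v))).
    by rewrite -!comp_lfunE vNv !id_lfunE.
  rewrite -(stab_op_comp uD (D_opp vD)); congr (_ \o _)%VF.
  rewrite -[LHS]comp_lfun1l -vNv -comp_lfunA lker0_compfV //.
  by rewrite comp_lfun1r.
- by move=> _ _ [u uD ->] [v vD ->]; rewrite !stab_op_comp // addrC.
Qed.

(** Rescaling [u] inside [D] makes its commutation phase with [e] equal to some [chi z] other than
    1; the error then sends the code to an orthogonal space. *)
Lemma stab_space_detects (e u : V) : u \in D -> symp u e != 0 ->
  detects w stab_space e.1 e.2.
Proof.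
move=> uD ue_neq0.
suff orth s v : s \in stab_space -> v \in stab_space ->
    inner s (XZ e.1 e.2 v) = 0.
  split=> [|_ _]; last exact: orth.
  by exists 0 => s v sU vU; rewrite mul0r orth.
move=> sU vU; have [z z_neq1] := chi_nontrivial p_prime k_gt0 cardK w_prim.
pose c := z / symp u e; pose u' := c *: u.
have u'D : u' \in D by rewrite -(addr0 u') D_lin.
have u'e : symp u' e = z by rewrite sympZl divfK.
have fix_ x : x \in stab_space -> XZ u'.1 u'.2 x = lam u' *: x.
  move=> /mem_stab_space/(_ _ u'D) {2}<-; rewrite /stab_op scale_lfunE scalerA.
  by rewrite divff ?lam_neq0 // scale1r.
set x := inner _ _.
(* Applying [XZ] at [u'] to both arguments preserves the inner product; it passes the error at the
   cost of [chi z] and acts on the code by a scalar of modulus 1. *)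
have x_eq : x = chi z * x.
  rewrite /x -[in LHS](inner_XZ p_prime k_gt0 cardK w_prim u'.1 u'.2).
  have -> : XZ u'.1 u'.2 (XZ e.1 e.2 v) = chi z *: XZ e.1 e.2 (XZ u'.1 u'.2 v).
    rewrite -!comp_lfunE !(XZ_comp p_prime k_gt0 cardK w_prim) !scale_lfunE scalerA.
    rewrite -(chiD p_prime k_gt0 cardK w_prim) -u'e /symp subrK.
    by rewrite !(addrC e.1, addrC e.2).
  rewrite !fix_ // linearZ /= !(innerZl, innerZr).
  have : lam u' * (lam u')^* = 1.
    rewrite -normCK; apply/eqP; rewrite sqrp_eq1 ?normr_ge0 //.
    rewrite -(@pexpr_eq1 _ _ (phase_order K)) ?normr_ge0 //; last first.
      rewrite /phase_order (fcharE p_prime k_gt0 cardK); case: ifP => //.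
      by rewrite prime_gt0.
    have /(congr1 Num.norm) := lam_phase u'D.
    by rewrite exprVn normfV normr1 normrX => /eqP; rewrite invr_eq1.
  move=> ll; set y := inner _ _.
  rewrite -[RHS]mul1r -ll; ring.
have /eqP : (1 - chi z) * x = 0 by rewrite mulrBl mul1r -x_eq subrr.
by rewrite mulf_eq0 subr_eq0 eq_sym (negPf z_neq1) => /eqP.
Qed.

End StabilizerOfIsotropic.

(** An error of weight below [d0] either fails to commute with an element of [D], hence is detected,
    or is trivial by the last hypothesis. The distance is the least weight of an undetected
    error. *)
Lemma stabilizer_code_of_isotropic (C : numClosedFieldType) (K : finFieldType)
    (w : C) (p k N s d0 : nat) (D : {set 'rV[K]_N * 'rV[K]_N}) :
  prime p -> (0 < k)%N -> #|K| = (p ^ k)%N -> p.-primitive_root w ->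
  (0 < N)%N -> 0 \in D ->
  (forall c u v, u \in D -> v \in D -> c *: u + v \in D) ->
  (forall u v, u \in D -> v \in D -> symp u v = 0) ->
  #|D| = (#|K| ^ s)%N ->
  (forall e, (forall u, u \in D -> symp u e = 0) ->
     (weight e.1 e.2 < d0)%N -> e = 0) ->
  exists (U : {vspace state C K N}) (k' d : nat),
    [/\ stabilizer_params w U k' d, (k' + s = N)%N & (d0 <= d)%N].
Proof.
move=> p_prime k_gt0 cardK w_prim N_gt0 D0 D_lin D_iso cardD D_dist.
have K_gt1 : (1 < #|K|)%N by apply: finNzRing_gt1.
have [lam [lam0 lam_neq0 lamM]] := phases_exist p_prime k_gt0 cardK w_prim D_lin D0 D_iso.
pose U := stab_space w D lam.
have dimU : (\dim U * #|D| = #|K| ^ N)%N.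
  exact (dim_stab_space p_prime k_gt0 cardK w_prim D_lin D0 lam0 lam_neq0 lamM).
have [U_neq0 U_stab] : stabilizer_code w U.
  exact (stab_space_stabilizer p_prime k_gt0 cardK w_prim D_lin D0 lam0 lam_neq0 lamM).
have dimU_gt0 : (0 < \dim U)%N by rewrite lt0n dimv_eq0.
have le_sN : (s <= N)%N.
  by rewrite -(leq_exp2l _ _ K_gt1) -cardD -dimU leq_pmull.
have dimUE : \dim U = (#|K| ^ (N - s))%N.
  apply/eqP; rewrite -(eqn_pmul2r (_ : 0 < #|D|)%N); last first.
    by apply/card_gt0P; exists 0.
  by rewrite dimU cardD -expnD subnK.
have small_det a b : (weight a b < d0)%N -> detects w U a b.
  move=> wt_ab; have [[u uD ue]|no_u] := pselect (exists2 u, u \in D & symp u (a, b) != 0).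
    exact (stab_space_detects p_prime k_gt0 cardK w_prim D_lin D0 lam0 lam_neq0 lamM uD ue).
  have [-> ->] : (a, b) = 0.
    apply: (D_dist (a, b)) => [u uD|//]; apply/eqP; apply: contrapT => /negP ue.
    by apply: no_u; exists u.
  rewrite /detects (XZ0 N p_prime k_gt0 cardK w_prim); split.
    by exists 1 => u v _ _; rewrite id_lfunE mul1r.
  by rewrite /weight (eq_card0 (_ : _ =i pred0)) // => i; rewrite !inE mxE eqxx.
have [a [b nd]] : exists a b, ~ detects w U a b.
  have [dimU_gt1|] := ltnP 1 (\dim U).
    exact: (undetected_exists p_prime k_gt0 cardK w_prim).
  move=> dimU_le1; have dimU1 : \dim U = 1%N by apply/eqP; rewrite eqn_leq dimU_le1.
  (* A one-dimensional code has [#|D|] equal to [#|K| ^ N] > 1; a nonzero element of [D] acts on it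
     by a nonzero scalar, which contradicts the orthogonality clause of [detects]. *)
  have [u uD u_neq0] : exists2 u, u \in D & u != 0.
    have : (1 < #|D|)%N 
      by move: dimU; rewrite dimU1 mul1n => ->; rewrite -(exp1n N) ltn_exp2r.
    case/card_gt1P => x [y [xD yD xy]]; have [x0|] := eqVneq x 0; last by exists x.
    by exists y; rewrite // -x0 eq_sym.
  exists u.1, u.2 => -[_ /(_ dimU1)].
  have wt_gt0 : (0 < weight u.1 u.2)%N.
    rewrite lt0n; apply: contra u_neq0 => /eqP/weight_eq0[u1 u2].
    by rewrite [u]surjective_pairing u1 u2.
  move=> /(_ wt_gt0 (vpick U) (vpick U) (memv_pick U) (memv_pick U)) /eqP.
  apply/negP.
  have /(mem_stab_space p_prime k_gt0 cardK w_prim D_lin D0 lam_neq0 lamM) pick_fix :=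
    memv_pick U.
  have -> : XZ w u.1 u.2 (vpick U) = lam u *: vpick U.
    have := pick_fix u uD.
    rewrite /stab_op scale_lfunE => {2}<-.
    by rewrite scalerA divff ?lam_neq0 // scale1r.
  by rewrite innerZr mulf_neq0 ?lam_neq0 // inner_eq0 vpick0.
have bad : exists d, `[< exists a b, weight a b = d /\ ~ detects w U a b >].
  by exists (weight a b); apply/asboolP; exists a, b.
pose d := ex_minn bad; exists U, (N - s)%N, d.
have [/asboolP[a' [b' [wt_d nd_d]]] d_min] :
    `[< exists a b, weight a b = d /\ ~ detects w U a b >]
    /\ forall d', `[< exists a b, weight a b = d' /\ ~ detects w U a b >] ->
         (d <= d')%N.
  by rewrite /d; case: ex_minnP.
split; [split=> //; split | exact: subnK | ].
- move=> x y wt_xy; apply: contrapT => nd_xy.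
  have : (d <= weight x y)%N by apply: d_min; apply/asboolP; exists x, y.
  by rewrite leqNgt wt_xy.
- by exists a', b'.
by rewrite leqNgt -wt_d; apply/negP => /small_det.
Qed.


(** * Finite fields and Hermitian codes *)

(** X^r - X = X (X^(r-1) - 1), and r - 1 divides r^c - 1. *)
Lemma dvdp_XnsubX (F : fieldType) (r c : nat) : (0 < r)%N ->
  ('X^r - 'X : {poly F}) %| 'X^(r ^ c) - 'X.
Proof.
move=> r_gt0.
have XnX n : (0 < n)%N -> 'X^n - 'X = 'X * ('X^(n.-1) - 1) :> {poly F}.
  by move=> n_gt0; rewrite mulrBr mulr1 -exprS prednK.
rewrite !XnX ?expn_gt0 ?r_gt0 // dvdp_mul2l ?polyX_eq0 //.
have /dvdnP[d ->] := dvdn_pred_predX r c.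
by rewrite mulnC exprM -[X in _ %| _ - X](expr1n _ d) subrXX dvdp_mulr.
Qed.

(** X^r - X divides the product of all X - x with x in [F], so it has r distinct roots there. *)
Lemma card_frob_fixed (F : finFieldType) (r c : nat) :
  (1 < r)%N -> #|F| = (r ^ c)%N -> #|[set x : F | x ^+ r == x]| = r.
Proof.
move=> r_gt1 cardF.
have sizeP : size ('X^r - 'X : {poly F}) = r.+1.
  by rewrite size_polyDl ?size_polyXn // size_polyN size_polyX ltnS.
have : 'X^r - 'X %| \prod_(x : F) ('X - x%:P).
  by rewrite -finField_genPoly cardF dvdp_XnsubX // ltnW.
move=> /dvdp_prod_XsubC[m Pm]; set s := mask m _ in Pm.
have s_uniq : uniq s by rewrite mask_uniq // index_enum_uniq.
have /esym := eqp_size Pm; rewrite size_prod_XsubC sizeP => -[size_s].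
rewrite -[RHS]size_s -(card_uniqP s_uniq); apply: eq_card => x.
by rewrite inE -root_prod_XsubC -(eqp_root Pm) rootE !hornerE subr_eq0.
Qed.

Lemma primitive_element_pow (K : finFieldType) :
  exists z : K, forall x, x != 0 -> exists i : nat, x = z ^+ i.
Proof.
have [u genu] : exists u : {unit K}, forall v, v \in <[u]>%g.
  have /cyclicP[u uP] := field_unit_group_cyclic [set: {unit K}]%G.
  by exists u => v; rewrite -uP inE.
exists (val u) => x x_neq0.
have xU : x \is a GRing.unit by rewrite unitfE.
have /cycleP[i xi] := genu (FinRing.unit K xU).
by exists i; have := congr1 val xi; rewrite /= => ->; rewrite FinRing.val_unitX.
Qed.

(* A generator of K is sent to a common root in F of the polynomials over F_p
   vanishing at it. *)
Lemma finField_embedding (K F : finFieldType) (p k c : nat) :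
  prime p -> #|K| = (p ^ k)%N -> #|F| = ((p ^ k) ^ c)%N ->
  exists f : {rmorphism K -> F}, True.
Proof.
move=> p_prime cardK cardF.
have pK : p \in [pchar K] by apply: card_finPcharP cardK p_prime.
have pF : p \in [pchar F].
  by apply: (@card_finPcharP _ _ (k * c)) p_prime; rewrite cardF -expnM.
pose K' : algType 'F_p := pPrimeCharType pK.
pose F' : algType 'F_p := pPrimeCharType pF.
have [z zP] := primitive_element_pow K.
pose evK : {rmorphism {poly 'F_p} -> K'} := horner_alg (z : K').
have genK x : exists P, evK P == x.
  have [->|/zP[i ->]] := eqVneq x 0; first by exists 0; rewrite rmorph0.
  by exists 'X^i; rewrite rmorphXn /=; apply/eqP; congr (_ ^+ _); apply: horner_algX.
pose lift x := xchoose (genK x).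
have liftK x : evK (lift x) = x by apply/eqP/(xchooseP (genK x)).
pose P0 : {poly 'F_p} := 'X^(p ^ k) - 'X.
have pk_gt1 : (1 < p ^ k)%N by rewrite -cardK finNzRing_gt1.
have sizeP0 : size P0 = (p ^ k).+1.
  by rewrite size_polyDl ?size_polyXn // size_polyN size_polyX ltnS.
have P0_neq0 : P0 != 0 by rewrite -size_poly_eq0 sizeP0.
have evP0 : evK P0 = 0.
  rewrite rmorphB rmorphXn /= [evK 'X]horner_algX -cardK.
  by apply/eqP; rewrite subr_eq0; apply/eqP/expf_card.
(* A nonzero polynomial of least size vanishing at [z] is a minimal polynomial of [z]; it divides
   [P0], which splits over [F]. *)
pose vanish d := `[< exists P, [/\ P != 0, evK P = 0 & size P = d] >].
have ex_van : exists d, vanish d by exists (size P0); apply/asboolP; exists P0.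
have [d /asboolP[m [m_neq0 evm <-]] m_min] := ex_minnP ex_van.
have m_dvd P : evK P = 0 -> m %| P.
  move=> evP; rewrite /dvdp; apply: contraT => rem_neq0.
  have := ltn_modp P m; rewrite m_neq0 ltnNge m_min //.
  apply/asboolP; exists (P %% m); split=> //.
  have := congr1 evK (divp_eq P m).
  by rewrite evP rmorphD rmorphM evm mulr0 add0r => /esym.
pose inF : {rmorphism 'F_p -> F'} := in_alg F'.
have : map_poly inF m %| \prod_(x : F) ('X - x%:P).
  rewrite -finField_genPoly cardF.
  apply: dvdp_trans (dvdp_XnsubX _ _ (ltnW pk_gt1)).
  have := m_dvd P0 evP0; rewrite -(dvdp_map inF).
  by rewrite rmorphB /= map_polyXn map_polyX.
move=> /dvdp_prod_XsubC[b mb].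
have size_m : (1 < size m)%N.
  rewrite ltnNge; apply: contraTN m_neq0 => /size1_polyC m_const.
  move: evm; rewrite m_const [evK _]horner_algC => /eqP.
  by rewrite scaler_eq0 oner_eq0 orbF polyC_eq0 negbK.
have [y ry] : exists y, root (map_poly inF m) y.
  have : (1 < size (map_poly inF m))%N by rewrite size_map_poly.
  rewrite (eqp_size mb) size_prod_XsubC; case def_s: (mask b _) mb => [//|y s] mb _.
  by exists y; rewrite (eqp_root mb) root_prod_XsubC mem_head.
pose evF : {rmorphism {poly 'F_p} -> F'} := horner_alg (y : F').
have evFm : evF m = 0 by apply/eqP: ry.
(* Two lifts of one element differ by a multiple of [m], which vanishes at [y]; so [f] is
   independent of the choice in [lift], and therefore a morphism. *)
have ev_eq P P' : evK P = evK P' -> evF P = evF P'.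
  move=> /eqP; rewrite -subr_eq0 -rmorphB => /eqP/m_dvd/dvdpP[g Pg].
  by apply/eqP; rewrite -subr_eq0 -rmorphB Pg rmorphM evFm mulr0.
pose f x := evF (lift x).
have fB : zmod_morphism f.
  by move=> u v; rewrite /f -rmorphB; apply: ev_eq; rewrite rmorphB !liftK.
have fM : monoid_morphism f.
  split; first by rewrite /f -(rmorph1 evF); apply: ev_eq; rewrite rmorph1 liftK.
  by move=> u v; rewrite /f -rmorphM; apply: ev_eq; rewrite rmorphM !liftK.
pose fadd := GRing.isZmodMorphism.Build K F f fB.
pose fmul := GRing.isMonoidMorphism.Build K F f fM.
pose g : {rmorphism K -> F} := HB.pack f fadd fmul.
by exists g.
Qed.

(** * From Hermitian to symplectic orthogonality *)

Section HermitianToSymplectic.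
Variables (F K : finFieldType) (iota : {rmorphism K -> F}) (Q m : nat).
Hypothesis cardK : #|K| = Q.
Variable gam : F.
Hypothesis gam_fix : gam ^+ (Q ^ 2) = gam.
Hypothesis gam_neq : gam ^+ Q != gam.
Hypothesis card_fix : #|[set x : F | x ^+ (Q ^ 2) == x]| = (Q ^ 2)%N.
Hypothesis frobD : forall x y : F, (x + y) ^+ Q = x ^+ Q + y ^+ Q.

Local Notation herm := (@Defs.hermitian F m Q).
Local Notation V := ('rV[K]_m * 'rV[K]_m)%type.

Let iotaQ x : iota x ^+ Q = iota x.
Proof. by rewrite -rmorphXn /= -cardK expf_card. Qed.

(** Coordinates of F_(Q^2) over F_Q in the basis 1, [gam]. *)
Definition glue (a b : K) : F := iota a + gam * iota b.

Lemma glue_conj a b : glue a b ^+ Q = iota a + gam ^+ Q * iota b.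
Proof. by rewrite frobD exprMn !iotaQ. Qed.

Lemma glue_inj : injective (fun u : K * K => glue u.1 u.2).
Proof.
move=> [a b] [a' b'] /= eq_ab.
have eq_ab' : gam * iota (b - b') = iota (a' - a).
  rewrite !rmorphB /=; transitivity (glue a b - (iota a + gam * iota b')).
    by rewrite /glue; ring.
  by rewrite eq_ab /glue; ring.
have [bb'|b_neq] := eqVneq (b - b') 0.
  move: eq_ab'; rewrite bb' rmorph0 mulr0 => /esym/eqP.
  rewrite fmorph_eq0 subr_eq0 => /eqP ->.
  by move/eqP: bb'; rewrite subr_eq0 => /eqP ->.
have gamE : gam = iota ((a' - a) / (b - b')).
  by rewrite fmorph_div -eq_ab' mulfK ?fmorph_eq0.
by move: gam_neq; rewrite gamE iotaQ eqxx.
Qed.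

Lemma glue_fix a b : glue a b ^+ (Q ^ 2) = glue a b.
Proof.
rewrite -mulnn exprM glue_conj frobD exprMn !iotaQ -exprM mulnn gam_fix.
by [].
Qed.

(** By counting: [glue] is injective, and source and target both have Q^2 elements. *)
Lemma glue_surj x : x ^+ (Q ^ 2) = x -> exists u : K * K, glue u.1 u.2 = x.
Proof.
move=> x_fix; pose f (u : K * K) := glue u.1 u.2.
suff /imsetP[u _ ->] : x \in f @: setT by exists u.
have /eqP -> : f @: setT == [set x : F | x ^+ (Q ^ 2) == x]; last by rewrite inE x_fix.
rewrite eqEcard card_fix card_imset; last exact: glue_inj.
rewrite cardsT card_prod cardK mulnn leqnn andbT.
by apply/subsetP => _ /imsetP[u _ ->]; rewrite inE glue_fix.
Qed.

Definition glue_row (u : V) : 'rV[F]_m := \row_j glue (u.1 0 j) (u.2 0 j).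

Lemma glue_row_inj : injective glue_row.
Proof.
move=> [a b] [a' b'] /rowP eq_ab; congr (_, _); apply/rowP => j.
  by have := eq_ab j; rewrite !mxE => /(@glue_inj (_, _) (_, _))[].
by have := eq_ab j; rewrite !mxE => /(@glue_inj (_, _) (_, _))[].
Qed.

Lemma glue_row_surj x : x \in subfield_words F m (Q ^ 2) ->
  exists u, glue_row u = x.
Proof.
rewrite inE => /forallP x_fix.
have ex j : exists u : K * K, glue u.1 u.2 == x 0 j.
  by have [u <-] := glue_surj (eqP (x_fix j)); exists u.
exists (\row_j (xchoose (ex j)).1, \row_j (xchoose (ex j)).2).
by apply/rowP => j; rewrite !mxE; apply/eqP/(xchooseP (ex j)).
Qed.

Lemma glue_row0 : glue_row 0 = 0.
Proof. by apply/rowP => j; rewrite !mxE /glue !rmorph0 mulr0 addr0. Qed.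

Lemma glue_rowZ c u : glue_row (c *: u) = iota c *: glue_row u.
Proof. by apply/rowP => j; rewrite !mxE /glue !rmorphM /=; ring. Qed.

Lemma glue_rowD u v : glue_row (u + v) = glue_row u + glue_row v.
Proof. by apply/rowP => j; rewrite !mxE /glue !rmorphD /=; ring. Qed.

Lemma weight_glue u : weight u.1 u.2 = #|[set j | glue_row u 0 j != 0]|.
Proof.
apply: eq_card => j; rewrite !inE mxE.
have -> : glue (u.1 0 j) (u.2 0 j) == 0 = ((u.1 0 j, u.2 0 j) == 0).
  by rewrite -(inj_eq glue_inj) /= /glue !rmorph0 mulr0 addr0.
by rewrite -[RHS]/(~~ (_ && _)) negb_and.
Qed.

(** The power Q fixes the image of [K], so the symmetric terms cancel. The factor is nonzero by the
    choice of [gam], hence Hermitian orthogonality in both orders gives symplectic orthogonality. *)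
Lemma hermitian_glue u v :
  herm (glue_row u) (glue_row v) - herm (glue_row v) (glue_row u)
  = (gam - gam ^+ Q) * iota (symp u v).
Proof.
rewrite /Defs.hermitian /symp /dot -!sumrB rmorph_sum mulr_sumr.
apply: eq_bigr => j _; rewrite !mxE !glue_conj /glue rmorphB !rmorphM /=.
by ring.
Qed.

Lemma hermitianZl c x y : herm (c *: x) y = c * herm x y.
Proof. by rewrite /Defs.hermitian mulr_sumr; apply: eq_bigr => j _; rewrite mxE mulrA. Qed.

Lemma hermitianZr c x y : herm x (c *: y) = c ^+ Q * herm x y.
Proof.
by rewrite /Defs.hermitian mulr_sumr; apply: eq_bigr => j _; rewrite mxE exprMn mulrCA.
Qed.

Variable C0 : {set 'rV[F]_m}.
Hypothesis C0_words : C0 \subset subfield_words F m (Q ^ 2).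
Hypothesis C0_lin : forall c x y, c ^+ (Q ^ 2) = c ->
  x \in C0 -> y \in C0 -> c *: x + y \in C0.
Hypothesis C00 : 0 \in C0.
Hypothesis C0_orth : forall x y, x \in C0 -> y \in C0 -> herm x y = 0.

Definition symp_code : {set V} := glue_row @^-1: C0.

Lemma symp_code_lin c u v :
  u \in symp_code -> v \in symp_code -> c *: u + v \in symp_code.
Proof.
rewrite !inE => uC vC; rewrite glue_rowD glue_rowZ C0_lin //.
by rewrite -mulnn exprM !iotaQ.
Qed.

Lemma symp_code_iso u v : u \in symp_code -> v \in symp_code -> symp u v = 0.
Proof.
rewrite !inE => uC vC; have := hermitian_glue u v.
rewrite !C0_orth // subrr => /esym/eqP; rewrite mulf_eq0 subr_eq0 eq_sym.
by rewrite (negPf gam_neq) fmorph_eq0 => /eqP.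
Qed.

Lemma card_symp_code : #|symp_code| = #|C0|.
Proof.
rewrite /symp_code -(card_imset _ glue_row_inj); apply: eq_card => x.
apply/imsetP/idP => [[u + ->]|xC]; first by rewrite inE.
have [u ux] := glue_row_surj (subsetP C0_words x xC).
by exists u; rewrite ?inE ux.
Qed.

(* Symplectic orthogonality to an F_(Q^2)-linear code upgrades to Hermitian
   orthogonality: compare x with gam *: x. *)
Lemma symp_orth_hermitian e : (forall u, u \in symp_code -> symp u e = 0) ->
  forall x, x \in C0 -> herm x (glue_row e) = 0.
Proof.
move=> e_orth x xC.
have herm_sym y : y \in C0 -> herm y (glue_row e) = herm (glue_row e) y.
  move=> yC; have [u uy] := glue_row_surj (subsetP C0_words y yC).
  apply/eqP; rewrite -subr_eq0 -uy hermitian_glue e_orth ?rmorph0 ?mulr0 //.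
  by rewrite inE uy.
have gx : gam *: x \in C0 by rewrite -[_ *: _]addr0 C0_lin.
have /eqP := herm_sym _ gx; rewrite hermitianZl hermitianZr herm_sym //.
rewrite -subr_eq0 -mulrBl mulf_eq0 subr_eq0 eq_sym (negPf gam_neq) => /eqP.
by [].
Qed.

End HermitianToSymplectic.

Lemma power_rmorphism (F : finFieldType) (p j : nat) : p \in [pchar F] ->
  exists phi : {rmorphism F -> F}, forall x, phi x = x ^+ (p ^ j).
Proof.
move=> pF; elim: j => [|j [phi phiE]]; first by exists idfun => x.
exists (pFrobenius_aut pF \o phi) => x /=.
by rewrite phiE expnSr exprM.
Qed.

(* The reduced row echelon form of a Frobenius-stable row space is fixed by
   Frobenius. *)
Lemma fixed_row_basis (F : fieldType) (phi : {rmorphism F -> F}) (k m : nat)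
    (M : 'M[F]_(k, m)) : (map_mx phi M <= M)%MS ->
  exists (f : 'I_(\rank M) -> 'I_m) (M0 : 'M[F]_(\rank M, m)),
    [/\ (M0 :=: M)%MS, map_mx phi M0 = M0 & colsub f M0 = 1%:M].
Proof.
move=> M_stable; pose B := row_base M.
have BM : (B :=: M)%MS := eq_row_base M.
have Bfull : row_full B^T by rewrite /row_full mxrank_tr BM.
pose f := fullrankfun Bfull; pose G := colsub f B.
have G_unit : G \in unitmx.
  rewrite -unitmx_tr (_ : G^T = rowsub f B^T) ?fullrowsub_unit //.
  by apply/matrixP => i j; rewrite !mxE.
have colsubM a (X : 'M_(a, _)) (Y : 'M[F]_(_, m)) : colsub f (X *m Y) = X *m colsub f Y.
  by apply/matrixP => i j; rewrite !mxE; apply: eq_bigr => l _; rewrite !mxE.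
pose M0 := invmx G *m B.
have M0M : (M0 :=: M)%MS.
  by apply: eqmx_trans BM; apply: eqmxMfull; rewrite row_full_unit unitmx_inv.
have M01 : colsub f M0 = 1%:M by rewrite colsubM mulVmx.
clearbody M0.
exists f, M0; split=> //.
have /submxP[X phiM0] : (map_mx phi M0 <= M0)%MS.
  rewrite M0M.
  have [Y ->] : exists Y, M0 = Y *m M by apply/submxP; rewrite M0M.
  by rewrite map_mxM (submx_trans (submxMl _ _)).
(* The columns selected by [f] form the identity, which Frobenius fixes; comparing these columns
   determines [X]. *)
have X1 : X = 1%:M.
  rewrite -[X]mulmx1 -M01 -colsubM -phiM0.
  rewrite M01; apply/matrixP => i j; have := congr1 (fun Y : 'M__ => Y i j) M01.
  by rewrite !mxE => ->; rewrite rmorph_nat.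
by rewrite phiM0 X1 mul1mx.
Qed.

Lemma card_subfield_words (F : finFieldType) (k R : nat) :
  #|[set x : F | x ^+ R == x]| = R -> #|subfield_words F k R| = (R ^ k)%N.
Proof.
move=> cardS; set S := [set x | _] in cardS.
pose row_of (f : {ffun 'I_k -> F}) := \row_j f j.
have row_of_inj : injective row_of.
  by move=> f g /rowP fg; apply/ffunP => j; have := fg j; rewrite !mxE.
rewrite -[X in _ = (X ^ _)%N]cardS -[X in _ = (_ ^ X)%N](card_ord k) -card_ffun_on.
rewrite -(card_imset _ row_of_inj).
apply: eq_card => x; rewrite inE; apply/forallP/imsetP => [x_fix|[f /ffun_onP fS ->] j].
  exists [ffun j => x 0 j]; last by apply/rowP => j; rewrite mxE ffunE.
  by apply/ffun_onP => j; rewrite ffunE inE; apply: x_fix.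
by have := fS j; rewrite inE /in_subfield /= mxE.
Qed.

(** * Frobenius-stable evaluation codes and their subfield-subcodes *)

Section StableEvaluationCode.
Variables (F : finFieldType) (m N R : nat) (beta : 'I_m -> F) (Gamma : {set 'Z_N}).

Definition eval_mx : 'M[F]_(#|Gamma|, m) :=
  \matrix_(a < #|Gamma|) ev beta 'X^(enum_val a : 'Z_N).

Lemma mem_eval_code x : (x \in eval_code beta Gamma) = (x <= eval_mx)%MS.
Proof.
have ev_sub i : i \in Gamma -> (ev beta 'X^i <= eval_mx)%MS.
  move=> iG; have -> : i = enum_val (enum_rank_in iG i) by rewrite enum_rankK_in.
  by rewrite -(rowK (fun a => ev beta 'X^(enum_val a : 'Z_N))) row_sub.
apply/idP/submxP => [|[u ->]]; last first.
  rewrite mulmx_sum_row; apply: memv_suml => a _; rewrite rowK memvZ //.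
  by apply: memv_span; apply: image_f; apply: enum_valP.
pose X := in_tuple [seq ev beta 'X^(i : 'Z_N) | i in Gamma].
move=> /(@coord_span _ _ _ X) ->; apply/submxP; apply: summx_sub => a _.
apply: scalemx_sub; have /imageP[i iG ->] : X`_a \in X by rewrite mem_nth.
exact: ev_sub.
Qed.

Lemma row_eval_mx i : i \in Gamma ->
  exists a, forall j, eval_mx a j = beta j ^+ i.
Proof.
move=> iG; exists (enum_rank_in iG i) => j.
by rewrite !mxE hornerXn enum_rankK_in.
Qed.

Variable phi : {rmorphism F -> F}.
Hypothesis phiE : forall x, phi x = x ^+ R.
Hypothesis Gamma_stable : forall i, i \in Gamma ->
  exists2 i', i' \in Gamma & forall j, (beta j ^+ i) ^+ R = beta j ^+ i'.
Hypothesis card_fix : #|[set x : F | x ^+ R == x]| = R.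

Lemma eval_mx_stable : (map_mx phi eval_mx <= eval_mx)%MS.
Proof.
apply/row_subP => a; have [i' i'G bi'] := Gamma_stable (enum_valP a).
have [a' a'P] := row_eval_mx i'G.
rewrite (_ : row a _ = row a' eval_mx) ?row_sub //.
by apply/rowP => j; rewrite [RHS]mxE a'P -bi' [LHS]mxE [LHS]mxE phiE !mxE hornerXn.
Qed.

(** The Frobenius-fixed echelon basis has entries in the subfield. Its combinations over the
    subfield are the subfield-subcode, and over [F] it still spans the whole evaluation code. *)
Lemma subfield_subcode_basis :
  let C0 := subfield_subcode R (eval_code beta Gamma) in
  exists (r : nat) (M0 : 'M[F]_(r, m)),
    [/\ (r <= #|Gamma|)%N, #|C0| = (R ^ r)%N, forall a, row a M0 \in C0
      & (eval_mx <= M0)%MS].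
Proof.
move=> C0; have [f [M0 [M0M M0phi M01]]] := fixed_row_basis eval_mx_stable.
have M0fix a j : M0 a j ^+ R = M0 a j by rewrite -phiE -[in RHS]M0phi mxE.
exists (\rank eval_mx), M0; split; last by rewrite M0M.
- exact: rank_leq_row.
- rewrite -(card_subfield_words _ card_fix).
  have M0_inj : injective (fun u : 'rV_(\rank eval_mx) => u *m M0).
    have colsubM (u : 'rV_(\rank eval_mx)) : colsub f (u *m M0) = u.
      rewrite -[RHS]mulmx1 -M01; apply/rowP => j; rewrite !mxE.
      by apply: eq_bigr => l _; rewrite !mxE.
    by move=> u v /(congr1 (colsub f)); rewrite !colsubM.
  rewrite -(card_imset _ M0_inj); apply: eq_card => x; rewrite inE mem_eval_code.
  apply/andP/imsetP => [[]|[u + ->]].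
    rewrite inE => /forallP x_fix; rewrite -M0M => /submxP[u xu].
    exists u => //; rewrite inE; apply/forallP => j.
    (* The identity columns of [M0] make [u 0 j] the entry of [x] in column [f j]. *)
    have := x_fix (f j); rewrite xu !mxE (eq_bigr (fun l => u 0 l * (l == j)%:R)).
      by rewrite (bigD1 j) //= eqxx mulr1 big1 ?addr0 // => l /negPf ->; rewrite mulr0.
    by move=> l _; have := congr1 (fun X : 'M__ => X l j) M01; rewrite !mxE => ->.
  rewrite !inE => /forallP u_fix; split; last by rewrite -M0M submxMl.
  apply/forallP => j; rewrite /in_subfield /= -phiE mxE rmorph_sum /=.
  apply/eqP/eq_bigr => l _; rewrite rmorphM !phiE M0fix.
  by rewrite (eqP (u_fix l)).
- move=> a; have aM : (row a M0 <= eval_mx)%MS.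
    by apply: submx_trans (row_sub _ _) _; rewrite M0M.
  rewrite !inE mem_eval_code aM andbT.
  by apply/forallP => j; rewrite /in_subfield /= mxE M0fix.
Qed.

End StableEvaluationCode.

(* Multiply by the polynomial vanishing on the rest of the support. *)
Lemma vandermonde_weight (F : finFieldType) (m d : nat) (beta : 'I_m -> F)
    (z : 'I_m -> F) : injective beta ->
  (forall i, (i < d)%N -> \sum_j beta j ^+ i * z j = 0) ->
  (#|[set j | z j != 0%R]| <= d)%N -> forall j, z j = 0.
Proof.
move=> beta_inj z_orth wt_z j0; apply/eqP; apply: contraTT isT => zj0.
pose S := [set j | z j != 0] :\ j0.
pose h := \prod_(j <- enum S) ('X - (beta j)%:P).
have size_h : (size h <= d)%N.
  rewrite size_prod_XsubC -cardE; apply: leq_trans wt_z.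
  by rewrite [in leqRHS](cardsD1 j0) inE zj0.
have : \sum_j h.[beta j] * z j = 0.
  rewrite (eq_bigr (fun j => \sum_(i < size h) h`_i * (beta j ^+ i * z j))); last first.
    by move=> j _; rewrite horner_coef mulr_suml; apply: eq_bigr => i _; rewrite mulrA.
  rewrite exchange_big big1 // => i _; rewrite -mulr_sumr z_orth ?mulr0 //.
  exact: leq_trans size_h.
have h_root j : (h.[beta j] == 0) = (j \in S).
  rewrite horner_prod prodf_seq_eq0; apply/hasP/idP => [[l]|jS].
    rewrite mem_enum => lS; rewrite /= !hornerE subr_eq0 => /eqP/beta_inj ->.
    by [].
  by exists j; rewrite ?mem_enum //= !hornerE subrr.
rewrite (bigD1 j0) //= big1 ?addr0 => [/eqP|j j_neq].
  by rewrite mulf_eq0 h_root (negPf zj0) !inE eqxx.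
have [->|zj] := eqVneq (z j) 0; first by rewrite mulr0.
by apply/eqP; rewrite mulf_eq0 h_root !inE j_neq zj.
Qed.

(** * Roots of the trace-depending polynomial *)

(** If [#|F|.-1] does not divide E, substituting [a * x] for a generator [a] multiplies the sum by
    [a ^+ E], which is not 1. For E = 0, comparing the sums of x and of x + 1 shows that the ones
    add up to 0. *)
Lemma sum_powers (F : finFieldType) (E : nat) :
  ~~ ((0 < E)%N && (#|F|.-1 %| E)%N) -> \sum_(x : F) x ^+ E = 0.
Proof.
have [->|E_gt0] := posnP E.
  move=> _; apply: (addrI (\sum_(x : F) x)); rewrite addr0 -big_split /=.
  by rewrite [RHS](reindex_inj (addIr 1)) /=.
rewrite /= => ndvd.
have [a a_neq0 aE] : exists2 a : F, a != 0 & a ^+ E != 1.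
  have /cyclicP[u uP] := field_unit_group_cyclic [set: {unit F}]%G.
  exists (val u); first by rewrite -unitfE (valP u).
  apply: contra ndvd => /eqP uE; rewrite -card_finField_unit.
  have -> : #|[set: {unit F}]| = #[u]%g by rewrite orderE -uP.
  by rewrite order_dvdn; apply/eqP/val_inj; rewrite FinRing.val_unitX.
apply: (mulfI (_ : a ^+ E - 1 != 0)); first by rewrite subr_eq0.
rewrite mulr0 mulrBl mul1r mulr_sumr; apply/eqP; rewrite subr_eq0; apply/eqP.
rewrite [RHS](reindex_inj (mulfI a_neq0)) /=; apply: eq_bigr => y _.
by rewrite exprMn.
Qed.

Section TraceRoots.
Variables (p e q n t : nat) (F : finFieldType).
Hypotheses (p_prime : prime p) (e_gt0 : (0 < e)%N) (q_def : q = (p ^ e)%N).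
Hypotheses (n_gt1 : (1 < n)%N) (t_gt0 : (0 < t)%N) (t_le_n : (t <= n)%N).
Hypothesis card_F : #|F| = (q ^ (2 * n))%N.

Local Notation N := (q ^ (2 * n) - 1)%N.
Local Notation J := (if t == n then n else 2 * n)%N.

Lemma pcharF : p \in [pchar F].
Proof.
by apply: (@card_finPcharP _ _ (e * (2 * n))) p_prime; rewrite card_F q_def -expnM.
Qed.

Lemma q_gt1 : (1 < q)%N.
Proof. by rewrite q_def -(exp1n e) ltn_exp2r ?prime_gt1. Qed.

Let q_gt0 : (0 < q)%N := ltnW q_gt1.

Lemma frobDX i (x y : F) : (x + y) ^+ (q ^ i) = x ^+ (q ^ i) + y ^+ (q ^ i).
Proof. by rewrite exprDn_pchar // q_def -expnM pnatX pnatE // pcharF. Qed.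

Lemma frobD_sum i (I : finType) (P : pred I) (f : I -> F) :
  (\sum_(j | P j) f j) ^+ (q ^ i) = \sum_(j | P j) f j ^+ (q ^ i).
Proof.
apply: (big_morph (fun x => x ^+ (q ^ i))) => [x y|]; first exact: frobDX.
by rewrite expr0n expn_eq0 -leqn0 leqNgt q_gt0.
Qed.

Lemma expfN (x : F) : x != 0 -> x ^+ N = 1.
Proof.
move=> x_neq0; apply: (mulfI x_neq0); rewrite mulr1 -exprS subn1 prednK.
  by rewrite -card_F expf_card.
by rewrite expn_gt0 q_gt0.
Qed.

Lemma exp_qmod j (x : F) : x ^+ (q ^ j) = x ^+ (q ^ (j %% (2 * n))).
Proof.
rewrite {1}(divn_eq j (2 * n)) mulnC expnD exprM.
congr (_ ^+ _); elim: (j %/ _)%N => [|d IHd]; first by rewrite muln0 expr1.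
by rewrite mulnS expnD exprM -card_F expf_card.
Qed.

Definition tr_value (x : F) : F := \sum_(i < J) (x ^+ (1 + q ^ t)) ^+ (q ^ i).

Lemma tr_value_fix x : tr_value x ^+ q = tr_value x.
Proof.
rewrite -[q in LHS]expn1 frobD_sum /tr_value; set y := x ^+ _.
(* For t = n the element [y] is a norm from [F] to F_(q^n), so n Frobenius steps already bring it
   back. *)
have yJ : y ^+ (q ^ J) = y.
  case: eqVneq => [t_n|_]; last by rewrite exp_qmod modnn expr1.
  rewrite /y -exprM mulnDl mul1n exprD -t_n -expnD addnn -mul2n t_n.
  by rewrite -card_F expf_card mulrC exprD expr1.
have J_gt0 : (0 < J)%N by case: ifP; lia.
rewrite (eq_bigr (fun i : 'I_J => y ^+ (q ^ i.+1))); last first.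
  by move=> i _; rewrite expn1 -exprM expnSr.
rewrite -(prednK J_gt0) big_ord_recr [RHS]big_ord_recl /= prednK // yJ.
by rewrite expn0 expr1 addrC.
Qed.

(** Reducing the exponents modulo N gives the remainder explicitly. Values at nonzero points are
    unchanged; so is the value at 0, because no exponent is a multiple of N. *)
Lemma root_Tr_poly x : root (Tr_poly F q n t) x = (1 + tr_value x == 0).
Proof.
have N_gt1 : (1 < N)%N.
  rewrite ltn_subRL; apply: (@leq_trans (2 ^ 2)) => //.
  by apply: (@leq_trans (q ^ 2)); rewrite ?leq_sqr ?q_gt1 // leq_exp2l ?q_gt1 //; lia.
pose d : {poly F} := 'X^N - 1.
have size_d : size d = N.+1 by rewrite /d -polyC1 size_XnsubC // ltnW.
pose a i := ((1 + q ^ t) * q ^ i)%N.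
pose R : {poly F} := 1 + \sum_(i < J) 'X^(a i %% N).
have TrE : Tr_poly F q n t = R.
  rewrite /Tr_poly -/d /P_poly /tr_poly.
  have PR : d %| (1 + \sum_(i < J) 'X^(1 + q ^ t) ^+ (q ^ i)) - R.
    rewrite opprD addrACA subrr add0r -sumrB.
    apply: (big_ind (fun P => d %| P)) => [|u v|i _]; [exact: dvdp0 | exact: dvdp_add | ].
    rewrite -exprM -/(a i) {1}(divn_eq (a i) N) exprD -[X in _ - X]mul1r -mulrBl.
    rewrite dvdp_mulr // mulnC exprM -[X in _ - X](expr1n _ (a i %/ N)).
    by rewrite subrXX dvdp_mulr.
  rewrite -[X in X %% d](subrK R) modpD (eqP PR) add0r modp_small //.
  rewrite size_d ltnS (leq_trans (size_polyD _ _)) // geq_max size_poly1 ltnW //=.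
  apply: (leq_trans (size_sum _ _ _)); apply/bigmax_leqP => i _.
  by rewrite size_polyXn ltn_pmod // ltnW.
rewrite TrE rootE /R hornerD hornerC horner_sum; congr (1 + _ == 0).
apply: eq_bigr => i _; rewrite hornerXn -exprM -/(a i).
have [->|x_neq0] := eqVneq x 0; last first.
  move: (a i) => l; rewrite {2}(divn_eq l N) exprD (mulnC (l %/ N)%N) exprM.
  by rewrite expfN // expr1n mul1r.
rewrite !expr0n; congr (_%:R); congr nat_of_bool.
have -> : (a i == 0%N) = false by rewrite /a muln_eq0 expn_eq0 (gtn_eqF q_gt0).
apply/negbTE; change (~~ (N %| (1 + q ^ t) * q ^ i)%N).
have cop : coprime N (q ^ i).
  rewrite coprimeXr // coprime_sym -(coprime_pexpl (k := 2 * n)) ?muln_gt0 //; last by lia.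
  by rewrite subn1 coprimenP // expn_gt0 q_gt0.
rewrite Gauss_dvdl // gtnNdvd // ltn_subRL.
have : (q ^ t <= q ^ n)%N by rewrite leq_exp2l ?q_gt1.
have : (2 ^ 2 <= q ^ n)%N.
  by apply: (@leq_trans (q ^ 2)); rewrite ?leq_sqr ?q_gt1 // leq_exp2l ?q_gt1.
by rewrite mul2n -addnn expnD; nia.
Qed.

(* Exponent of the k-th term of 1 + T(x), reduced by x^(q^(2n)) = x; the index 0
   stands for the constant 1. *)
Definition pair_wt (k : nat) : nat :=
  if k is i.+1 then (q ^ i + q ^ ((i + t) %% (2 * n)))%N else 0%N.

Lemma tr_value_sum x : 1 + tr_value x = \sum_(k < J.+1) x ^+ pair_wt k.
Proof.
rewrite big_ord_recl /= expr0; congr (1 + _); apply: eq_bigr => i _.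
rewrite /pair_wt /= add0n -exprM mulnDl mul1n -expnD !exprD.
by rewrite (addnC t i) (exp_qmod (i + t)).
Qed.

(* The indicator of [1 + tr_value x = 0] is [1 - (1 + tr_value x) ^+ (q - 1)]. *)
Lemma root_power_sum E :
  (forall f : {ffun 'I_(q - 1) -> 'I_J.+1}, let E' := (E + \sum_i pair_wt (f i))%N in
     ~~ ((0 < E')%N && (N %| E')%N)) ->
  \sum_(x | 1 + tr_value x == 0) x ^+ E = 0.
Proof.
move=> noE; have card_pred : #|F|.-1 = N by rewrite card_F subn1.
have sumE : \sum_(x : F) x ^+ E = 0.
  (* [pair_wt] is 0 at index 0, so the constant choice gives the hypothesis for [E] itself. *)
  apply: sum_powers; rewrite card_pred; have := noE [ffun=> ord0].
  by rewrite big1 ?addn0 // => i _; rewrite ffunE.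
rewrite big_mkcond (eq_bigr (fun x => x ^+ E - x ^+ E * (1 + tr_value x) ^+ (q - 1))).
  rewrite sumrB sumE sub0r; apply/eqP; rewrite oppr_eq0; apply/eqP.
  (* The power is expanded by choosing a term [f i] in each of its q - 1 factors. *)
  rewrite (eq_bigr (fun x => \sum_(f : {ffun 'I_(q - 1) -> 'I_J.+1})
             x ^+ (E + \sum_i pair_wt (f i))%N)); last first.
    have expE (c : F) : c ^+ (q - 1) = \prod_(i < q - 1) c by rewrite prodr_const card_ord.
    move=> x _; rewrite tr_value_sum expE bigA_distr_bigA mulr_sumr /=.
    apply: eq_bigr => f _.
    by rewrite exprD expr_sum.
  rewrite exchange_big big1 // => f _; apply: sum_powers; rewrite card_pred.
  exact: noE.
move=> x _; set c := 1 + _.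
have cq : c ^+ q = c by rewrite -[q in LHS]expn1 frobDX expn1 expr1n tr_value_fix.
have [->|c_neq0] := eqVneq c 0.
  by rewrite expr0n subn_eq0 leqNgt q_gt1 mulr0 subr0.
have -> : c ^+ (q - 1) = 1.
  by apply: (mulfI c_neq0); rewrite -exprS subn1 prednK // cq mulr1.
by rewrite mulr1 subrr.
Qed.

End TraceRoots.

(** * Fibre sizes of the trace function *)

Section RootCount.
Variables (p e q n t : nat) (F : finFieldType).
Hypotheses (p_prime : prime p) (e_gt0 : (0 < e)%N) (q_def : q = (p ^ e)%N).
Hypotheses (n_gt1 : (1 < n)%N) (t_gt0 : (0 < t)%N) (t_lt_n : (t < n)%N).
Hypothesis card_F : #|F| = (q ^ (2 * n))%N.

Local Notation T := (@tr_value q n t F).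

Let q_gt1 := q_gt1 p_prime e_gt0 q_def.
Let q_gt0 : (0 < q)%N := ltnW q_gt1.
Let frobDX := frobDX p_prime q_def card_F.

Lemma tr_valueE x : T x = \sum_(i < 2 * n) x ^+ (q ^ i) * x ^+ (q ^ ((i + t) %% (2 * n))).
Proof.
rewrite /tr_value ltn_eqF //; apply: eq_bigr => i _.
by rewrite -exprM mulnDl mul1n -expnD exprD (addnC t i) (exp_qmod card_F (i + t)).
Qed.

Definition shift_poly (z : F) : {poly F} :=
  \sum_(i < 2 * n) (z ^+ (q ^ ((i + t) %% (2 * n))) *: 'X^(q ^ i)
                    + z ^+ (q ^ i) *: 'X^(q ^ ((i + t) %% (2 * n)))) + (T z)%:P.

Lemma shift_polyE y z : (shift_poly z).[y] = T (y + z) - T y.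
Proof.
rewrite /shift_poly hornerD hornerC horner_sum !tr_valueE -big_split -sumrB /=.
by apply: eq_bigr => i _; rewrite !hornerE !frobDX; ring.
Qed.

(** The [z] for which the coefficient of X in [shift_poly z] vanishes. *)
Definition radical : {set F} := [set z | z ^+ (q ^ t) + z ^+ (q ^ (2 * n - t)) == 0].

Lemma shift_poly_neq0 z : z \notin radical -> shift_poly z != 0.
Proof.
rewrite inE => z_rad; apply/eqP => /(congr1 (fun P : {poly F} => P`_1)) /eqP.
apply/negP; rewrite coef0 /shift_poly big_split /= !coefD !coef_sum coefC addr0.
have n2_gt0 : (0 < 2 * n)%N by lia.
have q1 j : (1 == q ^ j)%N = (0 == j)%N by rewrite -{1}(expn0 q) eqn_exp2l.
have lt2 : (2 * n - t < 2 * n)%N by lia.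
rewrite (bigD1 (Ordinal n2_gt0)) //= [X in _ + X + _]big1 ?addr0; last first.
  move=> i i_neq0; rewrite coefZ coefXn q1.
  by rewrite eq_sym (_ : (i == 0 :> nat) = false) ?mulr0 //; apply/negbTE.
rewrite (bigD1 (Ordinal lt2)) //= [X in _ + (_ + X)]big1 ?addr0; last first.
  move=> i i_neq; rewrite coefZ coefXn q1.
  suff /negPf -> : 0%N != ((i + t) %% (2 * n))%N by rewrite mulr0.
  have i_lt := ltn_ord i; have {}i_neq : (i : nat) != (2 * n - t)%N by [].
  have [lt|ge] := ltnP (i + t) (2 * n); first by rewrite modn_small; lia.
  by rewrite -[(i + t)%N](subnK ge) modnDr modn_small; lia.
rewrite !coefZ !coefXn subnK ?modnn ?expn0 ?eqxx ?mulr1 ?add0n; last by lia.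
by rewrite modn_small //; lia.
Qed.

Definition shift_set (z : F) : {set F} := [set y | T (y + z) == T y].

Lemma card_shift_roots z : z \notin radical ->
  (#|shift_set z| <= q ^ (2 * n - 1))%N.
Proof.
move=> z_rad; have P_neq0 := shift_poly_neq0 z_rad.
have sizeP : (size (shift_poly z) <= (q ^ (2 * n - 1)).+1)%N.
  have le_exp j : (j < 2 * n)%N -> (q ^ j <= q ^ (2 * n - 1))%N.
    by move=> j_lt; rewrite leq_exp2l //; lia.
  rewrite (leq_trans (size_polyD _ _)) // geq_max andbC.
  rewrite (leq_trans (size_polyC_leq1 _)) //=.
  apply: (leq_trans (size_sum _ _ _)); apply/bigmax_leqP => i _.
  rewrite (leq_trans (size_polyD _ _)) // geq_max.
  rewrite !(leq_trans (size_scale_leq _ _)) // size_polyXn ltnS le_exp //.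
  by rewrite ltn_pmod //; lia.
rewrite cardE -ltnS; apply: leq_trans sizeP.
apply: max_poly_roots => //; last exact: enum_uniq.
by apply/allP => y; rewrite mem_enum inE rootE shift_polyE subr_eq0.
Qed.

(** Raising the defining equation to the power q^t gives z^(q^(2t)) + z = 0. *)
Lemma card_radical : (0 < #|radical| <= q ^ (2 * t))%N.
Proof.
have exp0 j : (0 : F) ^+ (q ^ j) = 0 by rewrite expr0n expn_eq0 (gtn_eqF q_gt0).
apply/andP; split; first by apply/card_gt0P; exists 0; rewrite inE !exp0 addr0.
pose P : {poly F} := 'X^(q ^ (2 * t)) + 'X.
have q2t : (1 < q ^ (2 * t))%N by rewrite -(expn0 q) ltn_exp2l //; lia.
have sizeP : size P = (q ^ (2 * t)).+1.
  by rewrite size_polyDl ?size_polyXn // size_polyX ltnS.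
rewrite cardE -ltnS -sizeP; apply: max_poly_roots; last exact: enum_uniq.
  by rewrite -size_poly_eq0 sizeP.
apply/allP => z; rewrite mem_enum inE rootE !hornerE => /eqP z_rad.
have := frobDX t (z ^+ (q ^ t)) (z ^+ (q ^ (2 * n - t))).
rewrite z_rad exp0 -!exprM -!expnD addnn -mul2n subnK; last by lia.
by rewrite -card_F expf_card => /esym/eqP.
Qed.

Let cnt (c : F) : nat := #|[set x | T x == c]|.
Let fixq : {set F} := [set c | c ^+ q == c].

Lemma T_fixq x : T x \in fixq.
Proof.
by rewrite inE (tr_value_fix p_prime e_gt0 q_def n_gt1 t_gt0 (ltnW t_lt_n) card_F).
Qed.

Lemma sum_cnt : (\sum_(c in fixq) cnt c = q ^ (2 * n))%N.
Proof.
rewrite -card_F -sum1_card [RHS](partition_big T (mem fixq)) /=; last first.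
  by move=> x _; apply: T_fixq.
by apply: eq_bigr => c _; rewrite /cnt -sum1_card; apply: eq_bigl => x; rewrite inE.
Qed.

(** Both sides count the pairs of points with equal value of T, the right one by their difference
    [z]. *)
Lemma sum_cnt2 :
  (\sum_(c in fixq) cnt c ^ 2 = \sum_z #|shift_set z|)%N.
Proof.
transitivity (\sum_y cnt (T y))%N.
  rewrite [RHS](partition_big T (mem fixq)) /=; last by move=> x _; apply: T_fixq.
  apply: eq_bigr => c _; rewrite (eq_bigr (fun=> cnt c)) => [|y /eqP-> //].
  rewrite sum_nat_const -mulnn; congr (_ * _)%N.
  by apply: eq_card => x; rewrite !inE.
rewrite (eq_bigr (fun y => \sum_z (T (y + z)%R == T y))%N); last first.
  move=> y _; rewrite /cnt -sum1_card big_mkcond /= (reindex_inj (addrI y)) /=.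
  by apply: eq_bigr => z _; rewrite inE; case: (_ == _).
rewrite exchange_big /=; apply: eq_bigr => z _.
by rewrite -sum1_card [RHS]big_mkcond; apply: eq_bigr => y _; rewrite inE; case: (_ == _).
Qed.

(** Shifts in the radical, at most q^(2t) in number, contribute at most q^(2n) each; all others
    contribute at most q^(2n-1). *)
Lemma sum_cnt2_lt :
  (\sum_(c in fixq) cnt c ^ 2 < q ^ (4 * n - 1) + q ^ (2 * n + 2 * t))%N.
Proof.
have /andP[rad_gt0 rad_le] := card_radical.
pose M := (q ^ (2 * n - 1))%N.
have M_gt0 : (0 < M)%N by rewrite expn_gt0 q_gt0.
have qM : (q ^ (2 * n) = q * M)%N by rewrite -expnS; congr (_ ^ _)%N; lia.
have qMM : (q ^ (4 * n - 1) = q * M * M)%N.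
  by rewrite -qM -expnD; congr (_ ^ _)%N; lia.
have : (\sum_z #|shift_set z|
        <= #|radical| * (q * M) + #|~: radical| * M)%N.
  rewrite (bigID (mem radical)) /= -!sum_nat_const leq_add ?leq_sum // => [z _|].
    by rewrite -qM -card_F max_card.
  rewrite [X in (_ <= X)%N](eq_bigl (fun z => z \notin radical)); last first.
    by move=> z; rewrite inE.
  by rewrite leq_sum // => z; apply: card_shift_roots.
rewrite -sum_cnt2 => /leq_ltn_trans; apply.
have := cardsC radical; rewrite card_F qM qMM expnD qM.
have := q_gt1; nia.
Qed.

(* Variance of the fibre sizes of T around their mean M: the fibre over -1 alone
   contributes (q^(2n-1-t))^2. *)
Lemma root_count_dim :
  #|[set x | 1 + T x == 0]| = (q ^ (2 * n - 1 - t) + q ^ (2 * n - 1))%N ->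
  (n <= 2 * t)%N.
Proof.
move=> card_roots; pose M := (q ^ (2 * n - 1))%N.
have cardfix : #|fixq| = q by apply: card_frob_fixed card_F.
have cntN1 : cnt (-1) = (q ^ (2 * n - 1 - t) + M)%N.
  by rewrite -card_roots; apply: eq_card => x; rewrite !inE addrC addr_eq0.
have N1_fix : -1 \in fixq.
  rewrite inE; have := frobDX 1 1 (-1); rewrite subrr expn1 expr1n.
  by rewrite expr0n (gtn_eqF q_gt0) => /esym/eqP; rewrite addrC addr_eq0.
have qM : (q ^ (2 * n) = q * M)%N by rewrite -expnS; congr (_ ^ _)%N; lia.
have qMM : (q ^ (4 * n - 1) = q * M * M)%N.
  by rewrite -qM -expnD; congr (_ ^ _)%N; lia.
(* The q fibre sizes have mean [M], so their variance sum is the sum of squares minus q M^2. *)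
have var : \sum_(c in fixq) ((cnt c)%:Z - M%:Z) ^+ 2 =
    (\sum_(c in fixq) cnt c ^ 2)%N%:Z - (q * M * M)%N%:Z.
  rewrite (eq_bigr (fun c => (cnt c ^ 2)%N%:Z - 2 * M%:Z * (cnt c)%:Z + (M ^ 2)%N%:Z)).
    rewrite big_split sumrB /= -mulr_sumr sumr_const cardfix -!PoszM.
    rewrite -!(big_morph Posz PoszD (erefl _)) sum_cnt qM.
    by rewrite -mulr_natl !PoszM; ring.
  by move=> c _; rewrite !PoszM; ring.
have : (q ^ (2 * n - 1 - t))%:Z ^+ 2 <= \sum_(c in fixq) ((cnt c)%:Z - M%:Z) ^+ 2.
  rewrite (bigD1 (-1)) //= cntN1 PoszD addrK lerDl sumr_ge0 // => c _.
  exact: sqr_ge0.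
rewrite var lerBrDr => le_var.
have := sum_cnt2_lt; rewrite qMM.
rewrite -ltz_nat PoszD => /(le_lt_trans le_var).
(* The exponents give 2(2n - 1 - t) < 2n + 2t, that is n - 1 < 2t. *)
by rewrite addrC ltrD2l expr2 -PoszM mulnn ltz_nat -expnM ltn_exp2l //; lia.
Qed.

End RootCount.

(** * Exponents below the designed bound *)

(** Used with P = q^n. The bounds on x and y leave only c = 1; then P divides x + 1, which is below
    2P. *)
Lemma two_digit_eq (P x y c : nat) :
  (1 < P)%N -> (x + 3 <= 2 * P)%N -> (y + 3 <= 2 * P)%N -> (0 < x + P * y)%N ->
  (x + P * y = c * (P * P - 1))%N -> (x + 1 = P)%N /\ (y + 1 = P)%N.
Proof.
move=> P_gt1 x_lt y_lt xy_gt0 xyc.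
have PP_gt0 : (1 < P * P)%N by nia.
have c1 : c = 1%N.
  case: c xyc => [|[|c]] //; first by lia.
  by rewrite !mulSn; nia.
have {}xyc : (x + 1 + P * y = P * P)%N by rewrite c1 mul1n in xyc; lia.
have [lt|] := ltnP (y + 1) P; first by nia.
move=> yP_ge; have yP : (y + 1 = P)%N by have [lt|] := ltnP P (y + 1); nia.
by split=> //; nia.
Qed.

(** Here x stands for q^(n-1), so that [q * x * x + x] is the largest pair weight for t = n. *)
Lemma size_ineq_top (q x g g' l : nat) :
  (1 < q)%N -> (g + 2 <= x)%N -> (g' + 2 <= x)%N -> (l <= q * x * g')%N ->
  (g + l + (q - 1) * (q * x * x + x) < q * x * (q * x) - 1)%N.
Proof.
move=> q_gt1 gx g'x l_le; set u := (q * x)%N in l_le *.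
have xu : (x <= u)%N by rewrite leq_pmull // ltnW.
have ux : (u * x <= u * u)%N by rewrite leq_mul2l xu orbT.
have ug' : (u * g' + u * 2 <= u * x)%N by rewrite -mulnDr leq_mul2l g'x orbT.
have -> : ((q - 1) * (u * x + x) = u * u + u - (u * x + x))%N.
  by rewrite mulnBl mul1n mulnDr (mulnCA q) -/u.
lia.
Qed.

(** Here x stands for q^(n-1) and y for q^(n-t); the bound on l expresses L <= n - 1. *)
Lemma size_ineq_B (q x y g g' l : nat) :
  (1 < q)%N -> (g + (q - 1) * y + q <= q * x)%N -> (g' + (q - 1) * y + q <= q * x)%N ->
  (l <= x * g')%N ->
  (g + l + (q - 1) * (x * (q * x) + x * y) < x * (q * x) * q - 1)%N.
Proof.
move=> q_gt1 gB g'B l_le; set u := (q * x)%N in gB g'B *.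
set v := ((q - 1) * y)%N in gB g'B.
have xg' : (x * g' + x * v + u <= x * u)%N.
  by rewrite [u in (_ + u <= _)%N]mulnC -!mulnDr leq_mul2l g'B orbT.
have -> : ((q - 1) * (x * u + x * y) = (q - 1) * (x * u) + x * v)%N.
  by rewrite mulnDr (mulnCA (q - 1)%N x y).
have -> : (x * u * q = (q - 1) * (x * u) + x * u)%N.
  by rewrite mulnBl mul1n subnK ?leq_pmull ?(ltnW q_gt1) // mulnC.
lia.
Qed.

(** Here x stands for q^(n-2) and z for q^(2n-1-t); the bound on l expresses L <= n - 2. *)
Lemma size_ineq_low (q x z g g' l : nat) :
  (1 < q)%N -> (q * q <= x)%N -> (z <= x * (q * x))%N ->
  (g + 2 <= q * (q * x))%N -> (g' + 2 <= q * (q * x))%N -> (l <= x * g')%N ->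
  (g + l + (q - 1) * (x * (q * (q * x)) * q + z) < x * (q * (q * x)) * (q * q) - 1)%N.
Proof.
move=> q_gt1 qx z_le gu g'u l_le; set u := (q * (q * x))%N in gu g'u *.
have xg' : (x * g' + x * 2 <= x * u)%N by rewrite -mulnDr leq_mul2l g'u orbT.
have qxx : (u <= x * (q * x))%N.
  by rewrite /u (mulnCA x) leq_mul2l leq_mul2r (leq_trans _ qx) ?leq_pmull ?orbT // ltnW.
have qz : ((q - 1) * z + x * (q * x) <= x * u)%N.
  rewrite /u (mulnCA x q (q * x)%N) -[X in (_ <= X * _)%N](subnK (ltnW q_gt1)) mulnDl mul1n.
  by rewrite leq_add2r leq_mul2l z_le orbT.
have -> : ((q - 1) * (x * u * q + z) = (q - 1) * (x * u * q) + (q - 1) * z)%N.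
  by rewrite mulnDr.
have -> : (x * u * (q * q) = (q - 1) * (x * u * q) + x * u * q)%N.
  by rewrite mulnBl mul1n subnK ?leq_pmull ?(ltnW q_gt1) // mulnA mulnC.
have : (x * u * 2 <= x * u * q)%N by rewrite leq_mul2l q_gt1 orbT.
lia.
Qed.

(** * Exponents that are not positive multiples of q^(2n) - 1 *)

Section Exponents.
Variables (q n t : nat).
Hypotheses (q_gt1 : (1 < q)%N) (n_gt1 : (1 < n)%N).
Hypotheses (t_gt0 : (0 < t)%N) (t_le_n : (t <= n)%N).

Local Notation N := (q ^ (2 * n) - 1)%N.
Local Notation J := (if t == n then n else 2 * n)%N.
Local Notation pair_wt := (pair_wt q n t).

Let leqX i j : (i <= j)%N -> (q ^ i <= q ^ j)%N.
Proof. by move=> le_ij; rewrite leq_exp2l. Qed.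

Let X_gt0 i : (0 < q ^ i)%N.
Proof. by rewrite expn_gt0 ltnW. Qed.

Let XS i : (0 < i)%N -> (q ^ i = q * q ^ (i - 1))%N.
Proof. by move=> i_gt0; rewrite -expnS subn1 prednK. Qed.

Lemma ltn_pairs k : (k < J.+1)%N -> (k <= 2 * n)%N.
Proof. by case: ifP => _; lia. Qed.

Lemma pair_wt_le k : (k <= 2 * n)%N ->
  (pair_wt k <= q ^ (2 * n - 1) + q ^ (2 * n - 1 - t))%N.
Proof.
case: k => [//|i] /= i_lt.
have [lt|ge] := ltnP (i + t) (2 * n).
  by rewrite modn_small // addnC leq_add // leqX; lia.
rewrite -[(i + t)%N](subnK ge) modnDr modn_small ?leq_add ?leqX //; lia.
Qed.

Lemma small_exponent g g' L (f : 'I_(q - 1) -> 'I_J.+1) :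
  (g + q ^ L * g' + (q - 1) * (q ^ (2 * n - 1) + q ^ (2 * n - 1 - t)) < N)%N ->
  ~~ ((0 < g + q ^ L * g' + \sum_i pair_wt (f i))%N
      && (N %| g + q ^ L * g' + \sum_i pair_wt (f i))%N).
Proof.
move=> small; set E := (g + _ + _)%N; apply/negP => /andP[E_gt0 /(dvdn_leq E_gt0)].
apply/negP; rewrite -ltnNge; apply: leq_ltn_trans small; rewrite leq_add2l.
rewrite -[X in (_ <= X * _)%N]card_ord -sum_nat_const leq_sum // => i _.
exact/pair_wt_le/ltn_pairs.
Qed.

(** As t - 1 <= n - 2, the left side is at most q^n - q^(n-2). Hence the base q^n digits of q - 1
    pair weights add up without carry. *)
Lemma pairs_total_lt :
  (t < n)%N -> ((q - 1) * (q ^ (n - 1) + q ^ (t - 1)) < q ^ n)%N.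
Proof.
move=> t_lt; have le_t : (q ^ (t - 1) <= q ^ (n - 2))%N by rewrite leqX //; lia.
rewrite (@XS n) ?(@XS (n - 1)); [|lia|lia].
rewrite -subnDA addn1; have := X_gt0 (n - 2); move: le_t.
by set x := (q ^ (n - 2))%N; set y := (q ^ (t - 1))%N; nia.
Qed.

(** The two powers of q lie either in the same base q^n digit, and the other digit is 0, or in
    different ones, and then one of them is at most q^(t-1). In the first case n <= 2t bounds the
    smaller power q^(n-1-t) by q^(t-1). *)
Lemma pair_wt_split k : (t < n)%N -> (n <= 2 * t)%N -> (k <= 2 * n)%N ->
  let lo := (pair_wt k %% q ^ n)%N in let hi := (pair_wt k %/ q ^ n)%N in
  [/\ (lo + hi <= q ^ (n - 1) + q ^ (t - 1))%N
    & (lo <= q ^ (t - 1))%N \/ (hi <= q ^ (t - 1))%N].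
Proof.
move=> t_lt n_le k_le.
have s_lt : (q ^ (n - 1) + q ^ (t - 1) < q ^ n)%N.
  by apply: leq_ltn_trans (pairs_total_lt t_lt); rewrite leq_pmull // subn_gt0.
suff [a [b [-> ab_le ab_min]]] : exists a b, [/\ pair_wt k = (b * q ^ n + a)%N,
    (a + b <= q ^ (n - 1) + q ^ (t - 1))%N & (a <= q ^ (t - 1))%N \/ (b <= q ^ (t - 1))%N].
  have a_lt : (a < q ^ n)%N by lia.
  by rewrite /= modnMDl divnMDl // modn_small // divn_small // addn0.
case: k k_le => [|i] i_lt /=; first by exists 0%N, 0%N; split=> //; left.
have [lt|ge] := ltnP (i + t) (2 * n).
  rewrite modn_small //; have [it_lt|it_ge] := ltnP (i + t) n.
    exists (q ^ i + q ^ (i + t))%N, 0%N; split; [lia| |by right].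
    by rewrite addn0 addnC leq_add // leqX; lia.
  have [i_ltn|i_gen] := ltnP i n.
    exists (q ^ i)%N, (q ^ (i + t - n))%N; split.
    - by rewrite -expnD subnK // addnC.
    - by rewrite leq_add // leqX; lia.
    - by right; rewrite leqX; lia.
  exists 0%N, (q ^ (i - n) + q ^ (i + t - n))%N; split; last by left.
    by rewrite mulnDl -!expnD !subnK // addn0.
  by rewrite add0n addnC leq_add // leqX; lia.
rewrite -[(i + t)%N](subnK ge) modnDr modn_small; last by lia.
exists (q ^ (i + t - 2 * n))%N, (q ^ (i - n))%N; split.
- by rewrite -expnD subnK //; lia.
- by rewrite addnC leq_add // leqX; lia.
- by left; rewrite leqX; lia.
Qed.

(** The case L = n: divisibility would force both base q^n digits of the total to be q^n - 1, which
    the bound A excludes. *)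
Lemma balanced_exponent g g' (f : 'I_(q - 1) -> 'I_J.+1) :
  (t < n)%N -> (n <= 2 * t)%N ->
  (if q == 2%N then g + q ^ (t - 1) + 2 <= q ^ n
   else g + uphalf (q - 1) * (q ^ (n - 1) + q ^ (t - 1)) + 2 <= q ^ n)%N ->
  (if q == 2%N then g' + q ^ (t - 1) + 2 <= q ^ n
   else g' + uphalf (q - 1) * (q ^ (n - 1) + q ^ (t - 1)) + 2 <= q ^ n)%N ->
  ~~ ((0 < g + q ^ n * g' + \sum_i pair_wt (f i))%N
      && (N %| g + q ^ n * g' + \sum_i pair_wt (f i))%N).
Proof.
move=> t_lt n_le g_le g'_le; set E := (g + _ + _)%N; apply/negP => /andP[E_gt0 N_dvd].
pose P := (q ^ n)%N; pose s := (q ^ (n - 1) + q ^ (t - 1))%N.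
pose lo i := (pair_wt (f i) %% P)%N; pose hi i := (pair_wt (f i) %/ P)%N.
have splitP i := pair_wt_split t_lt n_le (ltn_pairs (ltn_ord (f i))).
have WE : (\sum_i pair_wt (f i) = \sum_i lo i + P * \sum_i hi i)%N.
  rewrite big_distrr -big_split /=; apply: eq_bigr => i _.
  by rewrite [LHS](divn_eq _ P) addnC (mulnC P).
have W_le : (\sum_i lo i + \sum_i hi i <= (q - 1) * s)%N.
  rewrite -big_split /= -[X in (_ <= X * _)%N]card_ord -sum_nat_const leq_sum // => i _.
  by have [] := splitP i.
have s_lt : ((q - 1) * s < P)%N := pairs_total_lt t_lt.
have PP : (q ^ (2 * n) = P * P)%N by rewrite -expnD addnn mul2n.
set Wa := (\sum_i lo i)%N in WE W_le; set Wb := (\sum_i hi i)%N in WE W_le.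
have EE : E = ((g + Wa) + P * (g' + Wb))%N by rewrite /E WE -/P; lia.
have [gP g'P] : (g + 2 <= P)%N /\ (g' + 2 <= P)%N.
  split; [move: g_le | move: g'_le]; case: ifP => _; apply: leq_trans;
    by rewrite leq_add2r leq_addr.
have [x_eq y_eq] : (g + Wa + 1 = P)%N /\ (g' + Wb + 1 = P)%N.
  move: N_dvd; rewrite EE PP => /dvdnP[c Ec].
  have s_gt0 : (0 < (q - 1) * s)%N by rewrite muln_gt0 subn_gt0 q_gt1 addn_gt0 X_gt0.
  have [Wa_lt Wb_lt] : (Wa < P)%N /\ (Wb < P)%N.
    split; apply: leq_ltn_trans s_lt; apply: leq_trans W_le; first exact: leq_addr.
    exact: leq_addl.
  apply: (@two_digit_eq P _ _ c) => //; rewrite -?EE //; clear -gP g'P Wa_lt Wb_lt; lia.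
(* For q > 2, adding the two equalities gives 2P - 2, whereas A bounds the sum by 2P - 4, because
   twice the rounded-up half of q - 1 is at least q - 1. *)
have [q2|q_neq2] := eqVneq q 2%N; last first.
  move: g_le g'_le; rewrite (negPf q_neq2) -/s -/P => g_le g'_le.
  have : ((q - 1) * s <= 2 * (uphalf (q - 1) * s))%N.
    by rewrite mulnA leq_mul2r mul2n uphalfK leq_addl orbT.
  by clear -W_le x_eq y_eq g_le g'_le; lia.
move: g_le g'_le; rewrite q2 eqxx -q2 -/P => g_le g'_le.
(* For q = 2 there is a single pair, one of whose digits is at most q^(t-1); that half of the total
   then stays below P - 1. *)
have i0_lt : (0 < q - 1)%N by rewrite subn_gt0.
have uniq_i (i : 'I_(q - 1)) : i = Ordinal i0_lt.
  apply: val_inj; have := ltn_ord i; rewrite [X in (_ < X)%N](_ : _ = 1%N) ?q2 //.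
  by rewrite ltnS leqn0 => /eqP.
have sum1 (F : 'I_(q - 1) -> nat) : (\sum_i F i = F (Ordinal i0_lt))%N.
  by rewrite (bigD1 (Ordinal i0_lt)) //= big1 ?addn0 // => i /eqP[]; apply: uniq_i.
have [_] := splitP (Ordinal i0_lt); rewrite -/P -/(lo _) -/(hi _) -!sum1 -/Wa -/Wb.
by move=> lo_hi; clear -lo_hi q2 x_eq y_eq g_le g'_le; lia.
Qed.

Lemma top_exponent g g' L (f : 'I_(q - 1) -> 'I_J.+1) : t = n -> (L <= n)%N ->
  (g + 2 <= q ^ (n - 1))%N -> (g' + 2 <= q ^ (n - 1))%N ->
  ~~ ((0 < g + q ^ L * g' + \sum_i pair_wt (f i))%N
      && (N %| g + q ^ L * g' + \sum_i pair_wt (f i))%N).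
Proof.
move=> t_n L_le gP g'P; apply: small_exponent.
have -> : (2 * n - 1 - t = n - 1)%N by lia.
have -> : (2 * n - 1 = n + (n - 1))%N by lia.
rewrite mul2n -addnn !expnD (@XS n) ?(ltnW n_gt1) //.
apply: (@size_ineq_top q _ g g') => //.
by rewrite -XS ?(ltnW n_gt1) // leq_mul2r leqX ?orbT.
Qed.

Lemma B_exponent g g' L (f : 'I_(q - 1) -> 'I_J.+1) : (L < n)%N ->
  (g + (q - 1) * q ^ (n - t) + q <= q ^ n)%N ->
  (g' + (q - 1) * q ^ (n - t) + q <= q ^ n)%N ->
  ~~ ((0 < g + q ^ L * g' + \sum_i pair_wt (f i))%N
      && (N %| g + q ^ L * g' + \sum_i pair_wt (f i))%N).
Proof.
move=> L_lt gB g'B; apply: small_exponent.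
have -> : (2 * n - 1 - t = (n - 1) + (n - t))%N by lia.
have -> : (2 * n - 1 = (n - 1) + n)%N by lia.
have -> : (2 * n = (n - 1) + n + 1)%N by lia.
rewrite (@XS n) ?(ltnW n_gt1) // in gB g'B.
rewrite !expnD expn1 (@XS n) ?(ltnW n_gt1) //.
apply: (@size_ineq_B q _ _ g g') => //.
by rewrite leq_mul2r leqX ?orbT //; lia.
Qed.

Lemma low_exponent g g' L (f : 'I_(q - 1) -> 'I_J.+1) :
  (1 < t)%N -> (4 <= n)%N -> (L + 2 <= n)%N ->
  (g + 2 <= q ^ n)%N -> (g' + 2 <= q ^ n)%N ->
  ~~ ((0 < g + q ^ L * g' + \sum_i pair_wt (f i))%N
      && (N %| g + q ^ L * g' + \sum_i pair_wt (f i))%N).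
Proof.
move=> t_gt1 n_ge4 L_lt gP g'P; apply: small_exponent.
have le_t : (q ^ (2 * n - 1 - t) <= q ^ ((n - 2) + 1 + (n - 2)))%N.
  by rewrite leqX //; lia.
have qn : (q ^ n = q * (q * q ^ (n - 2)))%N by rewrite -!expnS; congr (_ ^ _)%N; lia.
have -> : (q ^ (2 * n - 1) = q ^ (n - 2) * (q * (q * q ^ (n - 2))) * q)%N.
  by rewrite -qn -expnD -expnSr; congr (_ ^ _)%N; lia.
have -> : (q ^ (2 * n) = q ^ (n - 2) * (q * (q * q ^ (n - 2))) * (q * q))%N.
  by rewrite -qn -expnD mulnn -expnD; congr (_ ^ _)%N; lia.
rewrite qn in gP g'P; apply: (@size_ineq_low q _ _ g g') => //.
- by rewrite mulnn leqX //; lia.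
- by rewrite -expnS -expnD (leq_trans le_t) // leqX //; lia.
- by rewrite leq_mul2r leqX ?orbT //; lia.
Qed.

End Exponents.

Lemma A_bound_lt (q n t g : nat) : (t < n)%N -> (n <= 2 * t)%N ->
  g%:R <= A_bound q n t ->
  (if q == 2%N then g + q ^ (t - 1) + 2 <= q ^ n
   else g + uphalf (q - 1) * (q ^ (n - 1) + q ^ (t - 1)) + 2 <= q ^ n)%N.
Proof.
move=> t_lt n_le; rewrite /A_bound t_lt; case: eqVneq => [->|q_neq2] /=.
  by rewrite -(ler_nat rat) !natrD !natrX; lra.
(* Under n <= 2t the first case of A occurs only for n = 2t, where it agrees with the second. *)
have eq_t : (2 * t <= n)%N -> (n - t - 1 = t - 1)%N by lia.
by case: ifP => [/eq_t ->|_]; rewrite -(ler_nat rat) !natrD natrM natrD !natrX; lra.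
Qed.

Lemma A_bound_eq (q n g : nat) : (0 < n)%N ->
  g%:R <= A_bound q n n -> (g + 2 <= q ^ (n - 1))%N.
Proof.
move=> n_gt0; rewrite /A_bound ltnn (_ : (2 * n <= n)%N = false); last by lia.
by case: eqVneq => [->|_] /=; rewrite -(ler_nat rat) natrD natrX; lra.
Qed.

Lemma B_bound_le (q n t g : nat) : (0 < q)%N -> g%:R <= B_bound q n t ->
  (g + (q - 1) * q ^ (n - t) + q <= q ^ n)%N.
Proof.
by move=> q_gt0; rewrite /B_bound -(ler_nat rat) !natrD natrM natrB // !natrX; lra.
Qed.

(** For t = 1, n <= 2t leaves only n = 2 and L = 1. Otherwise L = n is settled by A. For L < n, the
    bound B is used when n' = 1; when n' > 1, A is used if t = n, and a size estimate if t < n. *)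
Lemma designed_exponent (q n t n' g g' L : nat) (J := if t == n then n else (2 * n)%N)
    (f : 'I_(q - 1) -> 'I_J.+1) :
  (1 < q)%N -> (1 < n)%N -> (0 < t <= n)%N -> (n <= 2 * t)%N ->
  (0 < n' < n)%N -> (n' %| n)%N -> (0 < L <= n)%N -> L = n' %[mod 2 * n'] ->
  g%:R <= D_bound q n t n' -> g'%:R <= D_bound q n t n' ->
  ~~ ((0 < g + q ^ L * g' + \sum_i pair_wt q n t (f i))%N
      && (q ^ (2 * n) - 1 %| g + q ^ L * g' + \sum_i pair_wt q n t (f i))%N).
Proof.
move=> q_gt1 n_gt1 /andP[t_gt0 t_le_n] n_le_2t /andP[n'_gt0 n'_lt] n'_dvd.
move=> /andP[L_gt0 L_le] L_mod; rewrite /D_bound.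
have [t_gt1|t_le1] := ltnP 1 t; last first.
  have [t1 n2] : t = 1%N /\ n = 2%N by lia.
  have n'1 : n' = 1%N by lia.
  have L1 : L = 1%N.
    by move: L_mod L_le; rewrite n'1 n2 muln1; case: (L) L_gt0 => [|[|[|]]].
  have -> : (n != 2%N) = false by rewrite n2.
  move=> g_le g'_le.
  have {}g_le : (g + 2 <= q)%N by rewrite -(ler_nat rat) natrD; lra.
  have {}g'_le : (g' + 2 <= q)%N by rewrite -(ler_nat rat) natrD; lra.
  apply: small_exponent => //; rewrite L1 t1 n2.
  rewrite (_ : 2 * 2 - 1 - 1 = 2)%N // (_ : 2 * 2 - 1 = 3)%N // (_ : 2 * 2 = 4)%N // expn1.
  have qg' : (q * g' + q * 2 <= q * q)%N by rewrite -mulnDr leq_mul2l g'_le orbT.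
  have -> : ((q - 1) * (q ^ 3 + q ^ 2) = q ^ 4 - q ^ 2)%N.
    by rewrite mulnBl mul1n mulnDr -!expnS addnC subnDl.
  have le_q : (q ^ 2 <= q ^ 4)%N by rewrite leq_exp2l.
  rewrite mulnn in qg'; clear -g_le qg' le_q q_gt1; lia.
have useA : g%:R <= A_bound q n t -> g'%:R <= A_bound q n t -> (t = n \/ L = n) ->
  ~~ ((0 < g + q ^ L * g' + \sum_i pair_wt q n t (f i))%N
      && (q ^ (2 * n) - 1 %| g + q ^ L * g' + \sum_i pair_wt q n t (f i))%N).
  move=> gA g'A; have [t_lt|n_le_t] := ltnP t n.
    case=> [t_n|->]; first by rewrite t_n ltnn in t_lt.
    by apply: balanced_exponent => //; apply: A_bound_lt.
  have t_n : t = n by apply/eqP; rewrite eqn_leq t_le_n.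
  move=> _; apply: top_exponent => //.
    by apply: A_bound_eq; rewrite ?(ltnW n_gt1) // -{2}t_n.
  by apply: A_bound_eq; rewrite ?(ltnW n_gt1) // -{2}t_n.
have useB : g%:R <= B_bound q n t -> g'%:R <= B_bound q n t -> (L < n)%N ->
  ~~ ((0 < g + q ^ L * g' + \sum_i pair_wt q n t (f i))%N
      && (q ^ (2 * n) - 1 %| g + q ^ L * g' + \sum_i pair_wt q n t (f i))%N).
  by move=> gB g'B L_lt; apply: B_exponent => //; apply: B_bound_le => //; apply: ltnW.
have [n'1|n'_neq1] /= := eqVneq n' 1%N.
  (* For n' = 1, L is odd, so an even n excludes L = n. *)
  have L_odd : odd L by move: L_mod; rewrite n'1 muln1 !modn2; case: (odd L).
  case: ifP => [n_even|n_odd].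
    move=> gB g'B; apply: useB => //; rewrite ltn_neqAle L_le andbT.
    by apply: contraTneq L_odd => ->.
  rewrite !le_min => /andP[gA gB] /andP[g'A g'B].
  have [L_n|L_neq] := eqVneq L n; first by apply: useA => //; right.
  by apply: useB => //; rewrite ltn_neqAle L_neq.
move=> gA g'A; have [L_n|L_neq] := eqVneq L n; first by apply: useA => //; right.
have [t_lt|n_le_t] := ltnP t n; last first.
  by apply: useA => //; left; apply/eqP; rewrite eqn_leq t_le_n.
(* Both L and n are multiples of n' >= 2, so L < n leaves a gap of at least 2. *)
have n'_dvdL : (n' %| L)%N.
  by rewrite /dvdn -(@modn_dvdm (2 * n')) ?dvdn_mull // L_mod modn_dvdm ?dvdn_mull // modnn.
have L_lt2 : (L + 2 <= n)%N.
  have : (n' <= n - L)%N.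
    by rewrite dvdn_leq ?dvdn_sub // subn_gt0 ltn_neqAle L_neq.
  by clear -n'_gt0 n'_neq1 L_gt0; lia.
have n_ge4 : (4 <= n)%N.
  clear -n'_gt0 n'_neq1 n'_lt n'_dvd.
  by case/dvdnP: n'_dvd n'_lt => c ->; case: c => [|[|c]]; nia.
have bnd h : h%:R <= A_bound q n t -> (h + 2 <= q ^ n)%N.
  move/(A_bound_lt t_lt n_le_2t); clear -h.
  by case: ifP => _; lia.
by apply: low_exponent => //; apply: bnd.
Qed.

(** * Cyclotomic cosets and self-orthogonality *)

Lemma card_bigcup_le (I T : finType) (A : I -> {set T}) :
  (#|\bigcup_i A i| <= \sum_i #|A i|)%N.
Proof.
apply: (big_ind2 (fun (B : {set T}) k => (#|B| <= k)%N)) => //; first by rewrite cards0.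
by move=> B k B' k' Bk B'k'; rewrite cardsU (leq_trans (leq_subr _ _)) ?leq_add.
Qed.

Lemma modulus_gt1 (q n : nat) : (1 < q)%N -> (1 < n)%N -> (1 < q ^ (2 * n) - 1)%N.
Proof.
move=> q_gt1 n_gt1; rewrite ltn_subRL; apply: (@leq_trans (2 ^ 2)) => //.
by apply: (@leq_trans (q ^ 2)); rewrite ?leq_sqr // leq_exp2l //; lia.
Qed.

Section Cosets.
Variables (q n n' : nat).
Hypotheses (q_gt1 : (1 < q)%N) (n_gt1 : (1 < n)%N) (n'_le : (n' <= n)%N).

Local Notation N := (q ^ (2 * n) - 1)%N.
Local Notation r := (q ^ (2 * n'))%N.
Local Notation coset := (cyc_coset r (N := N)).

(** q^(2n-2n') is an inverse of r modulo N. Forward orbits are therefore cycles, and coset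
    membership is symmetric. *)
Lemma coset_mul_inj : injective (fun x : 'Z_N => r%:R * x).
Proof.
apply: (can_inj (g := fun x => (q ^ (2 * n - 2 * n'))%N%:R * x)) => x.
rewrite mulrA -natrM -expnD subnK ?leq_mul2l //.
transitivity ((N + 1)%N%:R * x).
  by congr (_%:R * x); rewrite subnK // expn_gt0 ltnW.
by rewrite natrD pchar_Zp ?modulus_gt1 // add0r mul1r.
Qed.

Lemma mem_coset_self (x : 'Z_N) : x \in coset x.
Proof. by rewrite inE connect0. Qed.

Lemma coset_stable (x y : 'Z_N) : y \in coset x -> r%:R * y \in coset x.
Proof. by rewrite !inE => xy; apply: connect_trans xy (fconnect1 _ _). Qed.

Lemma coset_sym (x y : 'Z_N) : (y \in coset x) = (x \in coset y).
Proof. by rewrite !inE (fconnect_sym coset_mul_inj). Qed.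

Lemma exists_minimal_rep (x : 'Z_N) :
  exists y : 'Z_N, [/\ minimal_rep r y, x \in coset y & (y <= x)%N].
Proof.
pose y := [arg min_(y < x in coset x) (y : nat)].
have [yx y_min] : y \in coset x /\ forall z, z \in coset x -> (y <= z)%N.
  by rewrite /y; case: arg_minnP => //; apply: mem_coset_self.
exists y; split; last exact: y_min (mem_coset_self x).
- apply/forallP => z; apply/implyP => zy; apply: y_min.
  by move: yx zy; rewrite !inE; apply: connect_trans.
- by rewrite coset_sym.
Qed.

End Cosets.

Lemma hermitian_eval_code (F : finFieldType) (m N Q : nat) (beta : 'I_m -> F)
    (Gamma : {set 'Z_N}) (phi : {rmorphism F -> F}) :
  (forall x, phi x = x ^+ Q) ->
  (forall i i', i \in Gamma -> i' \in Gamma ->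
     \sum_j beta j ^+ i * (beta j ^+ i') ^+ Q = 0) ->
  forall x y, x \in eval_code beta Gamma -> y \in eval_code beta Gamma ->
    Defs.hermitian Q x y = 0.
Proof.
move=> phiE orth x y; rewrite !mem_eval_code => /submxP[u ->] /submxP[v ->].
rewrite /Defs.hermitian.
rewrite (eq_bigr (fun j => \sum_a \sum_b (u 0 a * phi (v 0 b)) *
    (beta j ^+ (enum_val a : 'Z_N) * (beta j ^+ (enum_val b : 'Z_N)) ^+ Q))).
  rewrite exchange_big big1 // => a _; rewrite exchange_big big1 // => b _.
  by rewrite -mulr_sumr orth ?mulr0 ?enum_valP.
move=> j _; rewrite -phiE !mxE rmorph_sum mulr_suml; apply: eq_bigr => a _.
rewrite mulr_sumr; apply: eq_bigr => b _.
by rewrite !mxE !hornerXn rmorphM /= -!phiE mulrACA.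
Qed.

(** * Hermitian self-orthogonality of the evaluation code *)

Section SelfOrthogonality.
Variables (p e q n t n' m : nat) (F : finFieldType).
Hypotheses (p_prime : prime p) (e_gt0 : (0 < e)%N) (q_def : q = (p ^ e)%N).
Hypotheses (t_gt0 : (0 < t)%N) (t_le_n : (t <= n)%N).
Hypothesis card_F : #|F| = (q ^ (2 * n))%N.
Hypothesis m_def : m = (q ^ (2 * n - 1 - t) + q ^ (2 * n - 1))%N.
Variable beta : 'I_m -> F.
Hypothesis beta_inj : injective beta.
Hypothesis beta_roots : forall x : F,
  root (Tr_poly F q n t) x <-> exists j, beta j = x.
Hypotheses (n'_gt0 : (0 < n')%N) (n'_lt_n : (n' < n)%N) (n'_dvd_n : (n' %| n)%N).

Local Notation N := (q ^ (2 * n) - 1)%N.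
Local Notation T := (@tr_value q n t F).

Let q_gt1 : (1 < q)%N := q_gt1 p_prime e_gt0 q_def.
Let n_gt1 : (1 < n)%N := leq_ltn_trans n'_gt0 n'_lt_n.
Let frobD_sum := frobD_sum p_prime e_gt0 q_def card_F.

Lemma root_set : [set x | 1 + T x == 0] = beta @: setT.
Proof.
apply/setP => x; rewrite inE.
rewrite -(root_Tr_poly p_prime e_gt0 q_def n_gt1 t_gt0 t_le_n card_F).
apply/idP/imsetP => [/beta_roots[j <-]|[j _ ->]]; first by exists j.
by apply/beta_roots; exists j.
Qed.

Lemma n_le_2t : (n <= 2 * t)%N.
Proof.
have [t_lt|] := ltnP t n; last by lia.
apply: (root_count_dim p_prime e_gt0 q_def n_gt1 t_gt0 t_lt card_F).
by rewrite root_set card_imset // cardsT card_ord -m_def.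
Qed.

(** T vanishes at 0, so 0 is no root; this lets exponents of the [beta j] be reduced modulo N. *)
Lemma beta_neq0 j : beta j != 0.
Proof.
have : beta j \in [set x | 1 + T x == 0] by rewrite root_set imset_f.
rewrite inE; apply: contraTneq => ->.
rewrite /tr_value big1 ?addr0 ?oner_eq0 // => i _.
by rewrite expr0n addn_eq0 /= expr0n expn_eq0 (gtn_eqF (ltnW q_gt1)).
Qed.

Lemma beta_expmod j i : beta j ^+ i = beta j ^+ (i %% N).
Proof.
rewrite {1}(divn_eq i N) mulnC exprD exprM.
by rewrite (expfN p_prime e_gt0 q_def card_F) ?beta_neq0 // expr1n mul1r.
Qed.

Lemma designed_sum g g' L : (0 < L <= n)%N -> L = n' %[mod 2 * n'] ->
  g%:R <= D_bound q n t n' -> g'%:R <= D_bound q n t n' ->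
  \sum_j beta j ^+ (g + q ^ L * g') = 0.
Proof.
move=> L_bd L_mod g_le g'_le.
have -> : \sum_j beta j ^+ (g + q ^ L * g') =
    \sum_(x | 1 + T x == 0) x ^+ (g + q ^ L * g').
  rewrite (eq_bigl (mem (beta @: setT))) => [|x]; last first.
    by rewrite -[RHS]/(x \in beta @: setT) -root_set inE.
  rewrite big_imset /=; last by move=> i j _ _; apply: beta_inj.
  by apply: eq_bigl => j; rewrite inE.
apply: (root_power_sum p_prime e_gt0 q_def n_gt1 t_gt0 t_le_n card_F) => f.
apply: (@designed_exponent q n t n' g g' L f) => //; first by rewrite t_gt0.
  exact: n_le_2t.
by rewrite n'_gt0.
Qed.

(* Up to Frobenius, the exponent q ^ u * g + q ^ v * g' is g + q ^ L * g' or
   g' + q ^ L * g with 0 < L <= n. *)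
Lemma frobenius_reduced_sum a b g g' :
  g%:R <= D_bound q n t n' -> g'%:R <= D_bound q n t n' ->
  \sum_j beta j ^+ (q ^ (2 * n' * a) * g) * beta j ^+ (q ^ (2 * n' * b + n') * g') = 0.
Proof.
move=> g_le g'_le; pose u := (2 * n' * a)%N; pose v := (2 * n' * b + n')%N.
have frob0 s (f : 'I_m -> F) : \sum_j f j ^+ (q ^ s) = 0 -> \sum_j f j = 0.
  rewrite -frobD_sum => /eqP; rewrite expf_eq0 expn_gt0 (ltnW q_gt1) /=.
  by move/eqP.
have qmod j (x : F) : x ^+ (q ^ j) = x ^+ (q ^ (j %% (2 * n))).
  exact (exp_qmod card_F j x).
have n'2_dvd : (2 * n' %| 2 * n)%N by rewrite dvdn_pmul2l.
(* [s] is a natural number congruent to -u modulo 2n, so Frobenius by [s] cancels the factor q^u. *)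
pose s := ((2 * n - 1) * u)%N; pose L0 := ((s + v) %% (2 * n))%N.
have L0_mod : L0 = n' %[mod 2 * n'].
  rewrite /L0 modn_dvdm // /s /v /u.
  have -> : ((2 * n - 1) * (2 * n' * a) + (2 * n' * b + n') =
      ((2 * n - 1) * a + b) * (2 * n') + n')%N by lia.
  by rewrite modnMDl.
have L0_lt : (L0 < 2 * n)%N by rewrite ltn_pmod // muln_gt0 (ltnW n_gt1).
have L0_gt0 : (0 < L0)%N.
  rewrite lt0n; apply/eqP => L00; move: L0_mod; rewrite L00 mod0n modn_small.
    by move=> n'0; move: n'_gt0; rewrite -n'0.
  by rewrite -[X in (X < _)%N]mul1n ltn_pmul2r.
apply: (frob0 s).
have red j : (beta j ^+ (q ^ u * g) * beta j ^+ (q ^ v * g')) ^+ (q ^ s) =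
    beta j ^+ (g + q ^ L0 * g').
  rewrite exprMn exprD -!exprM; congr (_ * _).
    rewrite mulnAC -expnD mulnC exprM qmod.
    rewrite (_ : u + s = 2 * n * u)%N ?modnMr ?expn0 ?expr1 //.
    by rewrite /s mulnBl mul1n subnKC // leq_pmull // muln_gt0 (ltnW n_gt1).
  rewrite mulnAC -expnD mulnC exprM qmod addnC -/L0.
  by rewrite -exprM mulnC.
rewrite (eq_bigr _ (fun j _ => red j)).
have [L0_le|L0_gt] := leqP L0 n; first by apply: designed_sum; rewrite ?L0_gt0.
(* For L0 > n, Frobenius by 2n - L0 exchanges the roles of [g] and [g']. The congruence persists, as
   -n' and n' agree modulo 2n'. *)
pose L := (2 * n - L0)%N; apply: (frob0 L).
have red' j : (beta j ^+ (g + q ^ L0 * g')) ^+ (q ^ L) = beta j ^+ (g' + q ^ L * g).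
  rewrite !exprD exprMn mulrC -!exprM; congr (_ * _); last by rewrite mulnC.
  rewrite mulnAC -expnD mulnC exprM qmod subnKC ?modnn ?expn0 ?expr1 //.
  exact: ltnW.
rewrite (eq_bigr _ (fun j _ => red' j)); apply: designed_sum => //.
  by rewrite /L subn_gt0 L0_lt leq_subLR mul2n -addnn leq_add2r ltnW.
apply/eqP; rewrite -(eqn_modDr n'); apply/eqP.
rewrite -modnDmr -L0_mod modnDmr subnK ?(ltnW L0_lt) //.
by rewrite addnn -mul2n modnn; apply/eqP.
Qed.

Variables (omega : nat) (g : nat -> 'Z_N) (tau : nat).
Hypothesis g_incr : forall i j, (i < j <= omega)%N -> (g i < g j)%N.
Hypothesis tau_lt : (tau < omega)%N.
Hypothesis g_tau_le : (nat_of_ord (g tau))%:R <= D_bound q n t n'.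

Local Notation Gamma := (coset_union (q ^ (2 * n')) g tau).

Lemma mem_GammaP i : i \in Gamma -> exists a g0 : nat,
  g0%:R <= D_bound q n t n' /\
  forall j, beta j ^+ i = beta j ^+ (q ^ (2 * n' * a) * g0).
Proof.
case/bigcupP => l _ /(mem_cyc_coset _ _ _ (modulus_gt1 q_gt1 n_gt1))[a ->].
exists a, (g l); split; last by move=> j; rewrite -beta_expmod -expnM.
apply: le_trans g_tau_le; rewrite ler_nat.
have := ltn_ord l; rewrite ltnS leq_eqVlt => /orP[/eqP -> //|l_lt].
by apply/ltnW/g_incr; rewrite l_lt ltnW.
Qed.

Lemma Gamma_orth i i' : i \in Gamma -> i' \in Gamma ->
  \sum_j beta j ^+ i * (beta j ^+ i') ^+ (q ^ n') = 0.
Proof.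
move=> /mem_GammaP[a [g0 [g0_le iE]]] /mem_GammaP[b [g1 [g1_le i'E]]].
rewrite (eq_bigr (fun j => beta j ^+ (q ^ (2 * n' * a) * g0) *
                           beta j ^+ (q ^ (2 * n' * b + n') * g1))).
  exact: frobenius_reduced_sum.
by move=> j _; rewrite iE i'E -!exprM (mulnAC (q ^ (2 * n' * b))%N) -expnD.
Qed.

Lemma Gamma_frobenius i : i \in Gamma ->
  exists2 i', i' \in Gamma & forall j, (beta j ^+ i) ^+ (q ^ (2 * n')) = beta j ^+ i'.
Proof.
case/bigcupP => l _ il; exists ((q ^ (2 * n'))%:R * i).
  by apply/bigcupP; exists l => //; apply: coset_stable.
move=> j; rewrite -exprM beta_expmod.
suff -> : nat_of_ord ((q ^ (2 * n'))%:R * i) = ((i * q ^ (2 * n')) %% N)%N by [].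
rewrite -[i in LHS]natr_Zp -natrM val_Zp_nat ?modulus_gt1 //.
by rewrite mulnC.
Qed.

Hypothesis g_reps : forall x : 'Z_N,
  minimal_rep (q ^ (2 * n')) x <-> exists2 l, (l <= omega)%N & g l = x.

(** The minimal representative of the coset of i is at most i, hence below [g tau.+1], hence one of
    the first tau + 1 representatives. *)
Lemma small_in_Gamma (i : nat) : (i < g tau.+1)%N ->
  exists2 i0, i0 \in Gamma & nat_of_ord i0 = i.
Proof.
move=> i_lt; have N_gt1 := modulus_gt1 q_gt1 n_gt1.
have i_ltN : (i < N)%N.
  apply: ltn_trans i_lt _; apply: leq_trans (ltn_ord (g tau.+1)) _.
  by rewrite Zp_cast.
have i0E : nat_of_ord (i%:R : 'Z_N) = i by rewrite val_Zp_nat // modn_small.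
exists (i%:R : 'Z_N) => //.
have [y [/g_reps[l l_le <-] iy y_le]] :=
  exists_minimal_rep q_gt1 n_gt1 (ltnW n'_lt_n) (i%:R : 'Z_N).
have l_lt : (l < tau.+1)%N.
  rewrite ltnNge; apply/negP; rewrite leq_eqVlt => /orP[/eqP tl|tl].
    by move: y_le; rewrite i0E -tl leqNgt i_lt.
  have := @g_incr tau.+1 l; rewrite tl l_le => /(_ isT).
  by apply/negP; rewrite -leqNgt (leq_trans y_le) // i0E ltnW.
by apply/bigcupP; exists (Ordinal l_lt).
Qed.

Lemma card_Gamma :
  (#|Gamma| <= \sum_(l < tau.+1) #|cyc_coset (q ^ (2 * n')) (g l)|)%N.
Proof. exact: card_bigcup_le. Qed.

End SelfOrthogonality.

(* BCH bound: orthogonality to a basis of the code gives orthogonality to the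
   first d powers of beta. *)
Lemma orthogonal_weight (F : finFieldType) (m N Q d k : nat) (beta : 'I_m -> F)
    (Gamma : {set 'Z_N}) (M0 : 'M[F]_(k, m)) (y : 'rV[F]_m) :
  (0 < Q)%N -> injective beta ->
  (forall i, (i < d)%N -> exists2 i0, i0 \in Gamma & nat_of_ord i0 = i) ->
  (eval_mx beta Gamma <= M0)%MS ->
  (forall a, Defs.hermitian Q (row a M0) y = 0) ->
  (#|[set j | y 0%R j != 0%R]| <= d)%N -> y = 0.
Proof.
move=> Q_gt0 beta_inj Gamma_small M_sub orth wt_y.
(* The form raises the entries of [y] to the power Q, so the Vandermonde bound is applied to these
   powers, which have the same support. *)
have yQ j : (y 0 j ^+ Q == 0) = (y 0 j == 0) by rewrite expf_eq0 Q_gt0.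
apply/rowP => j; rewrite mxE; apply/eqP; rewrite -yQ; apply/eqP.
move: j; apply: (@vandermonde_weight F m d beta (fun j => y 0 j ^+ Q)) => // [i i_lt|].
  have [i0 i0G <-] := Gamma_small i i_lt.
  have [a aE] := row_eval_mx beta i0G.
  have /submxP[v vE] : (row a (eval_mx beta Gamma) <= M0)%MS.
    exact: submx_trans (row_sub _ _) M_sub.
  transitivity (\sum_l v 0 l * Defs.hermitian Q (row l M0) y); last first.
    by apply: big1 => l _; rewrite orth mulr0.
  rewrite /Defs.hermitian (eq_bigr (fun j => \sum_l v 0 l * (M0 l j * y 0 j ^+ Q))).
    rewrite exchange_big; apply: eq_bigr => l _; rewrite mulr_sumr.
    by apply: eq_bigr => j _; rewrite mxE.
  move=> j _; rewrite -aE -[eval_mx beta Gamma a j]/(_) -[LHS]/(_ * _).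
  have -> : eval_mx beta Gamma a j = \sum_l v 0 l * M0 l j.
    by have /rowP/(_ j) := vE; rewrite !mxE.
  by rewrite mulr_suml; apply: eq_bigr => l _; rewrite mulrA.
apply: leq_trans wt_y; apply/subset_leq_card/subsetP => j.
by rewrite !inE yQ.
Qed.

(** The fixed points of the power Q^2 outnumber those of the power Q. *)
Lemma subfield_generator (F : finFieldType) (Q c : nat) : (1 < Q)%N ->
  #|F| = ((Q ^ 2) ^ c)%N -> exists2 x : F, x ^+ (Q ^ 2) = x & x ^+ Q != x.
Proof.
move=> Q_gt1 cardF.
have cardQ2 : #|[set x : F | x ^+ (Q ^ 2) == x]| = (Q ^ 2)%N.
  by apply: card_frob_fixed cardF; rewrite -(exp1n 2) ltn_exp2r.
have cardQ : #|[set x : F | x ^+ Q == x]| = Q.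
  by apply: (@card_frob_fixed _ _ (2 * c)); rewrite ?cardF ?expnM.
have : ~~ ([set x : F | x ^+ (Q ^ 2) == x] \subset [set x | x ^+ Q == x]).
  apply/negP => /subset_leq_card; rewrite cardQ cardQ2 -{2}[Q]expn1 leq_exp2l //.
by case/subsetPn => x; rewrite !inE => /eqP; exists x.
Qed.

(** * From the evaluation code to the quantum code *)

Theorem theorem18
  (p e q n t n' m : nat)
  (p_prime : prime p) (e_gt0 : (0 < e)%N) (q_def : q = (p ^ e)%N)
  (n_gt0 : (0 < n)%N) (t_gt0 : (0 < t)%N) (t_le_n : (t <= n)%N)
  (not_223 : (q, n, (1 + q ^ t)%N) <> (2%N, 2%N, 3%N))
  (F : finFieldType) (card_F : #|F| = (q ^ (2 * n))%N)
  (m_def : m = (q ^ (2 * n - 1 - t) + q ^ (2 * n - 1))%N)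
  (beta : 'I_m -> F) (beta_inj : injective beta)
  (beta_roots : forall x : F,
     root (Tr_poly F q n t) x <-> exists j, beta j = x)
  (n'_gt0 : (0 < n')%N) (n'_lt_n : (n' < n)%N) (n'_dvd_n : (n' %| n)%N)
  (omega : nat) (g : nat -> 'Z_(q ^ (2 * n) - 1))
  (g_incr : forall i j, (i < j <= omega)%N -> (g i < g j)%N)
  (g_reps : forall x : 'Z_(q ^ (2 * n) - 1),
     minimal_rep (q ^ (2 * n')) x <-> exists2 l, (l <= omega)%N & g l = x)
  (tau : nat) (tau_lt : (tau < omega)%N)
  (g_tau_le : (nat_of_ord (g tau))%:R <= D_bound q n t n') :
  hermitian_self_orthogonal (q ^ n')
    (subfield_subcode (q ^ (2 * n'))
       (eval_code beta (coset_union (q ^ (2 * n')) g tau))) /\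
  forall (R : realType) (w : R[i]) (w_prim : p.-primitive_root w)
         (K : finFieldType) (card_K : #|K| = (q ^ n')%N),
  exists (U : {vspace state R[i] K m}) (k d : nat),
    [/\ stabilizer_params w U k d,
        m%:Z - 2 * (\sum_(l < tau.+1) #|cyc_coset (q ^ (2 * n')) (g l)|)%N%:Z
          <= k%:Z
      & (g tau.+1 + 1 <= d)%N].
Proof.
have q_gt1 : (1 < q)%N := q_gt1 p_prime e_gt0 q_def.
have n_gt1 : (1 < n)%N := leq_ltn_trans n'_gt0 n'_lt_n.
pose Q := (q ^ n')%N; set Gamma := coset_union _ g tau.
have Q_gt1 : (1 < Q)%N by rewrite -(expn0 q) ltn_exp2l.
have Q2 : (q ^ (2 * n') = Q ^ 2)%N by rewrite mulnC expnM.
have pF : p \in [pchar F] := pcharF p_prime q_def card_F.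
have power_phi i : exists phi : {rmorphism F -> F}, forall x, phi x = x ^+ (q ^ i).
  have [phi phiE] := power_rmorphism (e * i) pF; exists phi => x.
  by rewrite phiE q_def -expnM.
have [phi phiE] := power_phi n'; have [psi psiE] := power_phi (2 * n')%N.
have frobQ (x y : F) : (x + y) ^+ Q = x ^+ Q + y ^+ Q by rewrite -!phiE rmorphD.
have orth : forall x y, x \in eval_code beta Gamma -> y \in eval_code beta Gamma ->
    Defs.hermitian Q x y = 0.
  apply: (hermitian_eval_code phiE) => i i'.
  exact: (Gamma_orth p_prime e_gt0 q_def t_gt0 t_le_n card_F m_def beta_inj
            beta_roots n'_gt0 n'_lt_n n'_dvd_n g_incr tau_lt g_tau_le).
set C0 := subfield_subcode _ _.
have C0P x : (x \in C0) =
    (x \in subfield_words F m (Q ^ 2)) && (x \in eval_code beta Gamma).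
  by rewrite /C0 inE Q2.
have orthC0 x y : x \in C0 -> y \in C0 -> Defs.hermitian Q x y = 0.
  by rewrite !C0P => /andP[_ xE] /andP[_ yE]; apply: orth.
split=> [|R w w_prim K card_K].
  apply/subsetP => x xC; rewrite inE; have := xC; rewrite C0P => /andP[-> _] /=.
  by apply/forallP => y; apply/implyP => yC; apply/eqP/orthC0.
have [c n_def] := dvdnP n'_dvd_n.
have card_FQ2 : #|F| = ((Q ^ 2) ^ c)%N.
  by rewrite card_F -Q2 -expnM n_def; congr (_ ^ _)%N; rewrite -mulnA (mulnC c).
have card_Kp : #|K| = (p ^ (e * n'))%N by rewrite card_K q_def expnM.
have en'_gt0 : (0 < e * n')%N by rewrite muln_gt0 e_gt0.
have card_Fp : #|F| = ((p ^ (e * n')) ^ (2 * c))%N.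
  by rewrite -card_Kp card_K card_FQ2 expnM.
have [iota _] := finField_embedding p_prime card_Kp card_Fp.
have [gam gam_fix gam_neq] := subfield_generator Q_gt1 card_FQ2.
have card_fix : #|[set x : F | x ^+ (Q ^ 2) == x]| = (Q ^ 2)%N.
  by apply: card_frob_fixed card_FQ2; rewrite -(exp1n 2) ltn_exp2r.
have Gamma_frob := Gamma_frobenius p_prime e_gt0 q_def t_gt0 t_le_n card_F
  beta_roots n'_gt0 n'_lt_n.
have [r [M0 [r_le cardC0 M0C M_sub]]] : exists r (M0 : 'M[F]_(r, m)),
    [/\ (r <= #|Gamma|)%N, #|C0| = ((Q ^ 2) ^ r)%N, forall a, row a M0 \in C0
      & (eval_mx beta Gamma <= M0)%MS].
  rewrite -Q2; apply: (subfield_subcode_basis psiE) => [i iG|]; last by rewrite Q2.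
  exact: Gamma_frob iG.
have Gamma_small : forall i, (i < g tau.+1)%N ->
    exists2 i0, i0 \in Gamma & nat_of_ord i0 = i.
  exact: (small_in_Gamma p_prime e_gt0 q_def n'_gt0 n'_lt_n g_incr g_reps).
have C0_words : C0 \subset subfield_words F m (Q ^ 2).
  by apply/subsetP => x; rewrite C0P => /andP[].
have C0_lin a x y : a ^+ (Q ^ 2) = a -> x \in C0 -> y \in C0 -> a *: x + y \in C0.
  rewrite !C0P !inE => aQ /andP[/forallP x_fix xE] /andP[/forallP y_fix yE].
  rewrite memvD ?memvZ // andbT; apply/forallP => j.
  rewrite /in_subfield /= !mxE -Q2 -psiE rmorphD rmorphM !psiE Q2 aQ.
  by rewrite (eqP (x_fix j)) (eqP (y_fix j)).
have C00 : 0 \in C0.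
  rewrite C0P mem0v andbT inE; apply/forallP => j.
  by rewrite /in_subfield /= mxE expr0n expn_eq0 (gtn_eqF (ltnW Q_gt1)).
pose D := symp_code iota gam C0.
have D_lin a u v : u \in D -> v \in D -> a *: u + v \in D.
  exact: (symp_code_lin card_K C0_lin).
(* [D] has as many elements as [C0], namely (Q^2)^r, hence [#|K|] to the power 2r. The distance
   bound is one more than [g tau.+1], because [Gamma] contains all exponents below [g tau.+1]. *)
have [||||||U [k [d [U_params kr d_ge]]]] :=
  @stabilizer_code_of_isotropic R[i] K w p (e * n') m (2 * r) (g tau.+1).+1 D
    p_prime en'_gt0 card_Kp w_prim.
- by rewrite m_def addn_gt0 !expn_gt0 (ltnW q_gt1).
- by rewrite inE glue_row0.
- exact: D_lin.
- exact: (symp_code_iso card_K gam_neq frobQ orthC0).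
- rewrite (card_symp_code iota card_K gam_fix gam_neq card_fix frobQ C0_words).
  by rewrite cardC0 card_K expnM.
(* Gluing turns [u] into a word Hermitian orthogonal to the rows of [M0], which span the evaluation
   code over [F]; its weight is at most [g tau.+1], so it is 0. *)
- move=> u u_orth u_wt.
  apply: (glue_row_inj card_K gam_neq).
  rewrite glue_row0.
  apply: (@orthogonal_weight F m _ Q (g tau.+1) r beta Gamma M0) => //.
    exact: ltnW.
    move=> a.
    exact: (symp_orth_hermitian card_K gam_fix gam_neq card_fix frobQ C0_words
              C0_lin C00 u_orth (M0C a)).
  by rewrite -(weight_glue iota card_K gam_neq).
exists U, k, d; split=> //; last by rewrite addn1.
(* Here k = m - 2r, and r is at most the sum of the coset sizes. *)
have := leq_trans r_le (card_Gamma n' g tau).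
lia.
Qed.
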